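(* For $p\in(0,1)$ let $$\psi(p):=\sup\Big\{\int_{[0,1]^2}I_p(W(x,y))\,dx\,dy\;:\;W\in\mathcal{W},\ t_{\mathrm{ind}}(K_{1,3},W)=0\Big\}\,.$$ Then for all $p\in(0,1)$ we have $\psi(p)=-r_\ast(p)$, where $r_\ast(p)=-\log_2(1-p)$ for $p\in\big[0,\frac{3-\sqrt{5}}{2}\big)$ and $r_\ast(p)=-\frac12\log_2p$ for $p\in\big[\frac{3-\sqrt{5}}{2},1\big]$. Moreover: for all $p\in\big(0,\frac{3-\sqrt{5}}{2}\big)$ there is a unique graphon up to equivalence achieving $\psi(p)$; for $p=\frac{3-\sqrt{5}}{2}$ there are infinitely many pairwise nonequivalent graphons achieving $\psi(p)$; and for all $p\in\big(\frac{3-\sqrt{5}}{2},1\big)$ there is a unique graphon up to equivalence achieving $\psi(p)$.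
   Context: A graphon is a measurable symmetric function $W:[0,1]^2\to[0,1]$; $\mathcal{W}$ is the set of graphons. $I_p(x)=x\log_2\frac{p}{x}+(1-x)\log_2\frac{1-p}{1-x}$ (with $0\log_2(\cdot/0)=0$). The induced claw density is $t_{\mathrm{ind}}(K_{1,3},W)=\int_{[0,1]^4}\big(\prod_{i=2}^4W(x_1,x_i)\big)\big(\prod_{2\le i<j\le4}(1-W(x_i,x_j))\big)\,dx_1dx_2dx_3dx_4$. For a finite graph $F$, $t(F,W)=\int\prod_{uv\in E(F)}W(x_u,x_v)\prod_u dx_u$. Two graphons $W_1,W_2$ are equivalent if $t(F,W_1)=t(F,W_2)$ for every finite simple graph $F$. *)

(* Defs.v *)
From HB Require Import structures.
From mathcomp Require Import all_boot all_order all_algebra.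
From mathcomp Require Import all_classical all_reals all_analysis.

Set Implicit Arguments.
Unset Strict Implicit.
Unset Printing Implicit Defensive.

Import Order.TTheory GRing.Theory Num.Theory.
Import numFieldNormedType.Exports.

Local Open Scope classical_set_scope.
Local Open Scope ring_scope.

Section cons_measure.
Context (R : realType) (n : nat).
Local Notation mR := (measurableTypeR R).
Variable m : {sigma_finite_measure set (n.-tuple mR) -> \bar R}.

Definition cons_pair (z : mR * n.-tuple mR) : n.+1.-tuple mR :=
  [tuple of z.1 :: z.2].

Lemma measurable_cons_pair : measurable_fun setT cons_pair.
Proof.
apply: measurable_cons; first exact: measurable_fst.
exact: measurable_snd.
Qed.

(* The product of the Lebesgue measure on R and of m, transported to R^(n+1)
   along (x, t) |-> x :: t. *)
Definition cons_measure : set (n.+1.-tuple mR) -> \bar R :=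
  pushforward (@lebesgue_measure R \x m)%E cons_pair.

Let cons_measure0 : cons_measure set0 = 0%E.
Proof. by rewrite /cons_measure /pushforward preimage_set0 measure0. Qed.

Let cons_measure_ge0 A : (0 <= cons_measure A)%E.
Proof. by rewrite /cons_measure /pushforward; exact: measure_ge0. Qed.

Let cons_measure_sigma_additive : semi_sigma_additive cons_measure.
Proof.
have mc := measurable_cons_pair.
move=> F mF tF mUF; rewrite /cons_measure /pushforward preimage_bigcup.
apply: measure_semi_sigma_additive.
- by move=> k; rewrite -[X in measurable X]setTI; exact: mc.
- apply/trivIsetP => /= i j _ _ ij; rewrite -preimage_setI.
  by move/trivIsetP : tF => /(_ _ _ _ _ ij) ->//; rewrite preimage_set0.
- by rewrite -preimage_bigcup -[X in measurable X]setTI; exact: mc.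
Qed.

HB.instance Definition _ := isMeasure.Build _ _ _ cons_measure
  cons_measure0 cons_measure_ge0 cons_measure_sigma_additive.

Let cons_measure_sigma_finite : sigma_finite setT cons_measure.
Proof.
have /sigma_finiteP[F [FT ndF Foo]] := sigma_finiteT (@lebesgue_measure R).
have /sigma_finiteP[G [GT ndG Goo]] := sigma_finiteT m.
pose hd (t : n.+1.-tuple mR) : mR := tnth t ord0.
pose tl (t : n.+1.-tuple mR) : n.-tuple mR := [tuple of behead t].
have mhd : measurable_fun setT hd by exact: measurable_tnth.
have mtl : measurable_fun setT tl by exact: measurable_behead.
exists (fun k => hd @^-1` F k `&` tl @^-1` G k).
  apply/esym; rewrite -subTset => t _.
  have [i _ Fi] : (\bigcup_k F k) (hd t) by rewrite -FT.
  have [j _ Gj] : (\bigcup_k G k) (tl t) by rewrite -GT.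
  exists (maxn i j) => //; split => /=.
    by move: Fi; exact/subsetPset/ndF/leq_maxl.
  by move: Gj; exact/subsetPset/ndG/leq_maxr.
move=> k; have [mF Fk] := Foo k; have [mG Gk] := Goo k; split.
  apply: measurableI.
    by rewrite -[X in measurable X]setTI; exact: mhd.
  by rewrite -[X in measurable X]setTI; exact: mtl.
rewrite /cons_measure /pushforward.
rewrite (_ : _ @^-1` _ = F k `*` G k).
  by rewrite product_measure1E// lte_mul_pinfty// ge0_fin_numE.
apply/seteqP; split => -[x t] /=; rewrite /hd /tl /cons_pair /=.
  by rewrite (_ : [tuple of _] = t) //; exact: val_inj.
by rewrite (_ : [tuple of _] = t) //; exact: val_inj.
Qed.

HB.instance Definition _ := Measure_isSigmaFinite.Build _ _ _ cons_measure
  cons_measure_sigma_finite.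

End cons_measure.

Fixpoint lebesgue_tuple (R : realType) (n : nat) :
    {sigma_finite_measure set (n.-tuple (measurableTypeR R)) -> \bar R} :=
  match n with
  | 0 => (\d_([tuple] : 0.-tuple (measurableTypeR R)))%E
  | k.+1 => cons_measure (lebesgue_tuple R k)
  end.

Section graphons.
Context (R : realType).
Local Notation mR := (measurableTypeR R).
Local Notation mu := (@lebesgue_measure R).
Implicit Types (p x : R) (W : mR * mR -> mR).

Definition unit_itv : set mR := `[0, 1]%classic.

Definition cube (n : nat) : set (n.-tuple mR) :=
  [set t | forall i, unit_itv (tnth t i)].
Arguments cube n : clear implicits.

(* Only the values of W on [0,1]^2 matter. *)
Definition graphon W : Prop :=
  [/\ measurable_fun (unit_itv `*` unit_itv) W,
      forall x y, unit_itv x -> unit_itv y -> W (x, y) = W (y, x) &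
      forall x y, unit_itv x -> unit_itv y -> 0 <= W (x, y) <= 1].

Definition log2 x : R := ln x / ln 2.

(* The factors x and 1 - x vanish where the fractions have denominator 0, so
   the convention 0 log2(c/0) = 0 holds. *)
Definition I_ p x : R :=
  x * log2 (p / x) + (1 - x) * log2 ((1 - p) / (1 - x)).

(* Coordinate 0 is the centre of the claw, coordinates 1, 2, 3 its leaves. *)
Definition tind_claw W : \bar R :=
  (\int[lebesgue_tuple R 4%N]_(x in cube 4%N)
    ((\prod_(i < 4 | (0 < i)%N) W (tnth x ord0, tnth x i)) *
     (\prod_(i < 4 | (0 < i)%N) \prod_(j < 4 | (i < j)%N)
        (1 - W (tnth x i, tnth x j))))%:E)%E.

(* t(F, W) for the finite simple graph F with vertex set 'I_n and adjacency
   relation e. *)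
Definition hom_density (n : nat) (e : rel 'I_n) W : \bar R :=
  (\int[lebesgue_tuple R n]_(x in cube n)
    (\prod_(uv : 'I_n * 'I_n | (uv.1 < uv.2)%N && e uv.1 uv.2)
       W (tnth x uv.1, tnth x uv.2))%:E)%E.

Definition graphon_equiv W1 W2 : Prop :=
  forall (n : nat) (e : rel 'I_n), symmetric e -> irreflexive e ->
    hom_density e W1 = hom_density e W2.

Definition I_integral p W : \bar R :=
  (\int[mu \x mu]_(z in unit_itv `*` unit_itv) (I_ p (W z))%:E)%E.

Definition claw_free_graphon W : Prop := graphon W /\ tind_claw W = 0%E.

Definition psi p : \bar R :=
  ereal_sup [set I_integral p W | W in claw_free_graphon].

Definition achieves_psi p W : Prop :=
  claw_free_graphon W /\ I_integral p W = psi p.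

Definition unique_maximizer p : Prop :=
  (exists W, achieves_psi p W) /\
  (forall W1 W2, achieves_psi p W1 -> achieves_psi p W2 ->
     graphon_equiv W1 W2).

Definition infinitely_many_maximizers p : Prop :=
  exists W_ : nat -> mR * mR -> mR,
    (forall k, achieves_psi p (W_ k)) /\
    (forall k l, k != l -> ~ graphon_equiv (W_ k) (W_ l)).

Definition p_crit : R := (3 - Num.sqrt 5) / 2.

Definition rstar p : R :=
  if p < p_crit then - log2 (1 - p) else - (1 / 2) * log2 p.

End graphons.

(* Main.v *)
Require Import Defs.
From HB Require Import structures.
From mathcomp Require Import all_boot all_order all_algebra.
From mathcomp Require Import all_classical all_reals all_analysis.
From mathcomp Require Import measurable_realfun.
From mathcomp Require Import ring lra.

(* Colour a pair white, black or grey according as W is 0, 1 or strictly in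
   between. Since I_p is at most log2 (1 - p), log2 p and 0 on the three
   colours, with equality in the grey case only for W = p, the entropy of W is
   at most log2 (1 - p) * white + log2 p * black, where white + black + grey = 1.
   The key inequality is that a claw-free W satisfies grey <= black; then
   white + 2 * black >= 1, and the entropy is at most the larger of
   log2 (1 - p) and (log2 p) / 2, which cross at p_crit.

   Key inequality: let E be the indicator of the non-white pairs, F that of the
   non-black pairs, and e(x) the degree of x in E. For almost every c the kernel
   F is triangle-free on the E-neighbourhood of c, so by a weighted Mantel
   theorem black pairs carry at least half of the squared mass of that
   neighbourhood. Give x the mass e(x)^(-1/2) and integrate over c: the squared
   masses integrate to at least \int e by AM-GM, while the black pairs contribute
   at most the black density, because the codegree of x and y is at most
   (e(x) e(y))^(1/2). Hence \int e = grey + black is at most 2 * black.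

   Equality below p_crit forces black = 0, hence W = 0 almost everywhere. Above
   p_crit it forces white = 0 and makes F a triangle-free kernel of density 1/2,
   hence by equality in Mantel's theorem a complete bipartite kernel with parts
   of measure 1/2; then W is p on F and 1 elsewhere, and its densities do not
   depend on the parts. At p_crit, two cliques of equal size al joined by density
   p and surrounded by isolated vertices are optimal for every al <= 1/2. *)

Set Implicit Arguments.
Unset Strict Implicit.
Unset Printing Implicit Defensive.

Import Order.TTheory GRing.Theory Num.Theory.
Import numFieldNormedType.Exports.
Local Open Scope classical_set_scope.
Local Open Scope ring_scope.

(** * Means of bounded measurable functions under a probability *)

Section bounded_measurable.
Context (R : realType).

(** Such functions are integrable for every probability, and sums, products and partial means stay
    in the class, so it is the only integrability condition carried along below. *)
Definition bmeas d (T : measurableType d) (f : T -> R) :=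
  measurable_fun setT f /\ exists M : R, forall x, `|f x| <= M.

Section closure.
Context d (T : measurableType d).
Implicit Types f g : T -> R.

Lemma bmeas_cst (c : R) : bmeas (fun _ : T => c).
Proof. by split; [exact: measurable_cst|exists `|c|]. Qed.

Lemma bmeasD f g : bmeas f -> bmeas g -> bmeas (fun x => f x + g x).
Proof.
move=> [mf [M fM]] [mg [K gK]]; split; first exact: measurable_funD.
by exists (M + K) => x; rewrite (le_trans (ler_normD _ _))// lerD.
Qed.

Lemma bmeasN f : bmeas f -> bmeas (fun x => - f x).
Proof.
move=> [mf [M fM]]; split; first exact: measurableT_comp.
by exists M => x; rewrite normrN.
Qed.

Lemma bmeasM f g : bmeas f -> bmeas g -> bmeas (fun x => f x * g x).
Proof.
move=> [mf [M fM]] [mg [K gK]]; split; first exact: measurable_funM.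
by exists (M * K) => x; rewrite normrM ler_pM.
Qed.

Lemma bmeas_comp d' (T' : measurableType d') f (g : T' -> T) :
  bmeas f -> measurable_fun setT g -> bmeas (fun x => f (g x)).
Proof.
move=> [mf [M fM]] mg; split; first exact: measurableT_comp.
by exists M => x.
Qed.

Lemma bmeas_indic (A : set T) : measurable A -> bmeas (\1_A : T -> R).
Proof.
move=> mA; split; first exact: measurable_indic.
by exists 1 => x; rewrite indicE; case: (_ \in _); rewrite /= ?normr1 ?normr0.
Qed.

End closure.

Section integrable.
Context d (T : measurableType d) (P : probability T R).

Lemma bmeas_integrable f : bmeas f -> P.-integrable setT (EFin \o f).
Proof.
move=> [mf [M fM]]; apply: measurable_bounded_integrable => //.
  exact: le_lt_trans (probability_le1 P measurableT) (ltry 1).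
exists M; split; first exact: num_real.
by move=> K MK x _ /=; rewrite (le_trans (fM x))// ltW.
Qed.

End integrable.

Context d (T : measurableType d) (P : probability T R).

Local Notation "'J_' x , f" := (Rintegral P setT (fun x => f))
  (at level 200, x name, f at level 200, only parsing).
Local Notation J := (Rintegral P setT).

Lemma bmeas_integralE f : bmeas f -> (\int[P]_x (f x)%:E = (J f)%:E)%E.
Proof.
move=> bf; have fi := bmeas_integrable P bf; rewrite /Rintegral fineK//.
exact: (integrable_fin_num measurableT fi).
Qed.

Lemma eqJ f g : f =1 g -> J f = J g.
Proof. by move=> /funext ->. Qed.

Lemma JD f g : bmeas f -> bmeas g -> (J_ x, f x + g x) = J f + J g.
Proof. by move=> /(bmeas_integrable P) ? /(bmeas_integrable P) ?; rewrite RintegralD. Qed.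

Lemma JB f g : bmeas f -> bmeas g -> (J_ x, f x - g x) = J f - J g.
Proof. by move=> /(bmeas_integrable P) ? /(bmeas_integrable P) ?; rewrite RintegralB. Qed.

Lemma JZ c f : bmeas f -> (J_ x, c * f x) = c * J f.
Proof. by move=> /(bmeas_integrable P) ?; rewrite RintegralZl. Qed.

Lemma JZr c f : bmeas f -> (J_ x, f x * c) = J f * c.
Proof. by move=> /(bmeas_integrable P) ?; rewrite RintegralZr. Qed.

Lemma Jcst c : (J_ _, c) = c.
Proof. rewrite Rintegral_cst// [X in fine X](_ : _ = 1%E) ?mulr1//.
exact: probability_setT. Qed.

Lemma J_ge0 f : (forall x, 0 <= f x) -> 0 <= J f.
Proof. by move=> f0; apply: Rintegral_ge0. Qed.

Lemma le_J f g : bmeas f -> bmeas g -> (forall x, f x <= g x) -> J f <= J g.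
Proof.
by move=> /(bmeas_integrable P) ? /(bmeas_integrable P) ? fg; apply: le_Rintegral.
Qed.

Lemma J_eq0_ae f : bmeas f -> (forall x, 0 <= f x) -> J f = 0 ->
  {ae P, forall x, f x = 0}.
Proof.
move=> bf f0 Jf.
have : ae_eq P setT (EFin \o f) (cst 0%E).
  apply/ae_eq_integral_abs => //; first by case: bf => ? _; exact/measurable_EFinP.
  under eq_integral do rewrite /= ger0_norm//.
  by rewrite bmeas_integralE// Jf.
by apply: filterS => x /= /(_ Logic.I) [].
Qed.

Lemma le_J_ae f g : bmeas f -> bmeas g -> {ae P, forall x, f x <= g x} ->
  J f <= J g.
Proof.
move=> bf bg fg; rewrite -subr_ge0 -JB//.
(* [integral_ge0] asks for a sign everywhere, so [g - f] is replaced by its positive part, which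
   agrees with it almost everywhere. *)
pose h x := g x - f x.
have bh : bmeas h by apply: bmeasD => //; apply: bmeasN.
have hE : (\int[P]_x (h x)%:E = \int[P]_x (Num.max (h x) 0)%:E)%E.
  apply: ae_eq_integral => //.
  - by apply/measurable_EFinP; case: bh.
  - apply/measurable_EFinP; apply: measurable_maxr => //; by case: bh.
  by apply: filterS fg => x fgx _; rewrite max_l// subr_ge0.
rewrite /Rintegral hE fine_ge0// integral_ge0// => x _.
by rewrite lee_fin le_max lexx orbT.
Qed.

(** Null sets are encoded by a nonnegative [h] of mean zero: an almost everywhere statement becomes
    a pointwise one on the zero set of [h]. Vanishing claw densities are used in this form. *)
Lemma le_J_on0 h f g : bmeas h -> (forall x, 0 <= h x) -> J h = 0 ->
  bmeas f -> bmeas g -> (forall x, h x = 0 -> f x <= g x) -> J f <= J g.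
Proof.
move=> bh h0 Jh bf bg fg; apply: le_J_ae => //.
by apply: filterS (J_eq0_ae bh h0 Jh).
Qed.

Lemma eq_J_on0 h f g : bmeas h -> (forall x, 0 <= h x) -> J h = 0 ->
  bmeas f -> bmeas g -> (forall x, h x = 0 -> f x = g x) -> J f = J g.
Proof.
move=> bh h0 Jh bf bg fg; apply/eqP; rewrite eq_le.
by apply/andP; split; apply: (le_J_on0 bh) => // x /fg ->.
Qed.

(** Supplies typical points. If [h] had no zero, [1 <= 0] would hold vacuously on its zero set,
    hence also for the means. *)
Lemma J_eq0_ex h : bmeas h -> (forall x, 0 <= h x) -> J h = 0 ->
  exists x, h x = 0.
Proof.
move=> bh h0 Jh; apply: contrapT => /forallNP nh.
have := le_J_on0 bh h0 Jh (bmeas_cst _ 1) (bmeas_cst _ 0).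
by rewrite !Jcst ler10 => /(_ (fun x hx => False_ind _ (nh x hx))).
Qed.

Lemma bmeas_J d' (T' : measurableType d') (f : T' * T -> R) :
  bmeas f -> bmeas (fun x => J_ y, f (x, y)).
Proof.
move=> bf; have [mf [M fM]] := bf; split; last first.
  exists M => x.
  have bfx : bmeas (fun y => f (x, y)).
    by apply: bmeas_comp => //; exact: measurable_pair1.
  apply: (le_trans (le_normr_Rintegral _ (bmeas_integrable P bfx))) => //.
  rewrite -[leRHS]Jcst; apply: le_J => //; last exact: bmeas_cst.
  split; last by exists M => y; rewrite normr_id.
  by apply: measurableT_comp => //; case: bfx.
(* Tonelli's theorem gives measurability of partial integrals for nonnegative integrands, so [f] is
   shifted up by [M'] and the shift is subtracted afterwards. *)
pose M' := `|M|.
have f0 z : 0 <= f z + M'.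
  by have := fM z; rewrite ler_norml => /andP[+ _]; have := ler_norm M; rewrite -/M'; lra.
rewrite (_ : (fun _ => _) = fun x => (fine (\int[P]_y (f (x, y) + M')%:E)%E) - M').
  apply: measurable_funB => //; apply: measurableT_comp => //.
  apply: (measurable_fun_fubini_tonelli_F (fun z => (f z + M')%:E)) => //.
  by apply/measurable_EFinP; apply: measurable_funD.
apply/funext => x.
have bfx : bmeas (fun y => f (x, y)).
  by apply: bmeas_comp => //; exact: measurable_pair1.
have := JD bfx (bmeas_cst _ M'); rewrite {1}/Rintegral => ->.
by rewrite Jcst addrK.
Qed.

Lemma bmeas_prod_integrable (f : T * T -> R) : bmeas f ->
  (P \x P)%E.-integrable setT (EFin \o f).
Proof. exact: (@bmeas_integrable _ _ (P \x P)%E). Qed.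

Lemma Jprod (f : T * T -> R) : bmeas f ->
  (\int[(P \x P)%E]_z (f z)%:E = (J_ x, J_ y, f (x, y))%:E)%E.
Proof.
move=> bf; rewrite -(@integral12_prod_meas1 _ _ _ _ _ P P (EFin \o f)); last first.
  exact: bmeas_prod_integrable.
rewrite -bmeas_integralE; last exact: bmeas_J.
apply: eq_integral => x _; apply: (@bmeas_integralE (fun y => f (x, y))).
by apply: bmeas_comp => //; exact: measurable_pair1.
Qed.

Lemma Jswap (f : T * T -> R) : bmeas f ->
  (J_ x, J_ y, f (x, y)) = J_ y, J_ x, f (x, y).
Proof.
move=> bf; apply: EFin_inj; rewrite -Jprod//.
rewrite -(@integral21_prod_meas1 _ _ _ _ _ P P (EFin \o f)); last first.
  exact: bmeas_prod_integrable.
rewrite -bmeas_integralE; last first.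
  apply: (@bmeas_J _ _ (fun z => f (z.2, z.1))).
  by apply: bmeas_comp => //; apply: measurable_swap.
apply: eq_integral => y _; apply: (@bmeas_integralE (fun x => f (x, y))).
by apply: bmeas_comp => //; exact: measurable_pair2.
Qed.

End bounded_measurable.

(** * Syntax-directed proofs of measurability and boundedness *)

Ltac solve_measurable :=
  lazymatch goal with
  | |- measurable_fun _ (fun z => z) => exact: measurable_id
  | |- measurable_fun _ fst => exact: measurable_fst
  | |- measurable_fun _ snd => exact: measurable_snd
  | |- measurable_fun _ (fun z => (@?a z, @?b z)) =>
      apply: (@measurable_fun_pair _ _ _ _ _ _ a b); solve_measurable
  | |- measurable_fun _ (fun z => (@?a z).1) =>
      apply: (@measurableT_comp _ _ _ _ _ _ fst setT a measurable_fst);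
      solve_measurable
  | |- measurable_fun _ (fun z => (@?a z).2) =>
      apply: (@measurableT_comp _ _ _ _ _ _ snd setT a measurable_snd);
      solve_measurable
  | |- measurable_fun _ (fun z => ?c) => exact: measurable_cst
  end.

Ltac solve_bmeas :=
  lazymatch goal with
  | |- bmeas (fun z => @?a z + @?b z) =>
      apply: (@bmeasD _ _ _ a b); solve_bmeas
  | |- bmeas (fun z => - @?a z) => apply: (@bmeasN _ _ _ a); solve_bmeas
  | |- bmeas (fun z => @?a z * @?b z) =>
      apply: (@bmeasM _ _ _ a b); solve_bmeas
  | |- bmeas (fun z => (@?a z) ^+ 2) =>
      apply: (@bmeasM _ _ _ a a); solve_bmeas
  | |- bmeas (fun z => Rintegral ?P setT (@?f z)) =>
      let g := eval cbv beta in (fun zy => f zy.1 zy.2) in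
      apply: (@bmeas_J _ _ _ _ _ _ g); solve_bmeas
  | H : bmeas ?F |- bmeas ?F => exact: H
  | |- bmeas (fun z => ?F (@?g z)) =>
      first [exact: bmeas_cst
            |apply: (@bmeas_comp _ _ _ _ _ F g); [solve_bmeas|solve_measurable]]
  | _ => exact: bmeas_cst
  end.

(** * Triangle-free and claw-free kernels *)

Section kernels.
Context (R : realType) d (T : measurableType d) (P : probability T R).

Local Notation "'J_' x , f" := (Rintegral P setT (fun x => f))
  (at level 200, x name, f at level 200, only parsing).
Local Notation J := (Rintegral P setT).

Definition kernel_deg (u : T -> R) (F : T * T -> R) x := J_ y, u y * F (x, y).

Lemma bmeas_kernel_deg u F : bmeas u -> bmeas F -> bmeas (kernel_deg u F).
Proof. by move=> bu bF; rewrite /kernel_deg; solve_bmeas. Qed.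

Lemma kernel_degE u F : bmeas u -> bmeas F ->
  (J_ x, J_ y, u x * u y * F (x, y)) = J_ x, u x * kernel_deg u F x.
Proof.
move=> bu bF; apply: eqJ => x; rewrite /kernel_deg -JZ; last by solve_bmeas.
by apply: eqJ => y; ring.
Qed.

(** In a triangle-free graph a third point is joined to at most one end of an edge. Pointwise this
    is [F (x, y) * ((1 - F (x, z)) * (1 - F (y, z))) >= 0]; expanded and integrated, it compares two
    copies of the second moment of the degree with the mass times the edge density. *)
Lemma triangle_free_degree_le (u : T -> R) (F : T * T -> R) :
  bmeas u -> bmeas F -> (forall x, 0 <= u x) -> (forall z, 0 <= F z <= 1) ->
  (forall x y, F (x, y) = F (y, x)) ->
  (J_ x, J_ y, J_ z, u x * u y * u z * (F (x, y) * F (y, z) * F (x, z))) = 0 ->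
  2 * (J_ x, u x * kernel_deg u F x ^+ 2) <=
    J u * (J_ x, J_ y, u x * u y * F (x, y)).
Proof.
move=> bu bF u0 F01 Fsym tri0.
pose D := kernel_deg u F; rewrite -/D.
have bD : bmeas D by exact: bmeas_kernel_deg.
set N := J u; set t := (J_ x, J_ y, u x * u y * F (x, y)).
(* [A1] and [A2] are paths of length two centred at [x] and at [y]; [A3] is an edge with a free
   third vertex. *)
pose A1 x y z := u x * u y * u z * (F (x, y) * F (x, z)).
pose A2 x y z := u x * u y * u z * (F (x, y) * F (y, z)).
pose A3 x y z := u x * u y * u z * F (x, y).
have E1 : (J_ x, J_ y, J_ z, A1 x y z) = J_ x, u x * D x ^+ 2.
  apply: eqJ => x; rewrite /A1.
  transitivity (J_ y, (u x * u y * F (x, y)) * D x).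
    apply: eqJ => y; rewrite /D -JZ; last by solve_bmeas.
    by apply: eqJ => z; ring.
  rewrite JZr; last by solve_bmeas.
  rewrite expr2 mulrA; congr (_ * _); rewrite /D -JZ; last by solve_bmeas.
  by apply: eqJ => z; ring.
have E2 : (J_ x, J_ y, J_ z, A2 x y z) = J_ x, u x * D x ^+ 2.
  rewrite -E1 (@Jswap _ _ _ P (fun z => J_ w, A2 z.1 z.2 w)); last first.
    by rewrite /A2; solve_bmeas.
  apply: eqJ => x; apply: eqJ => y; apply: eqJ => z; rewrite /A1 /A2 /=.
  by rewrite (Fsym y x); ring.
have E3 : (J_ x, J_ y, J_ z, A3 x y z) = N * t.
  rewrite /t -JZ; last by solve_bmeas.
  apply: eqJ => x; rewrite -JZ; last by solve_bmeas.
  apply: eqJ => y; rewrite /N mulrC -JZ; last by solve_bmeas.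
  by apply: eqJ => z; rewrite /A3; ring.
have sum_le0 : (J_ x, J_ y, J_ z, A1 x y z + A2 x y z - A3 x y z) <= 0.
  rewrite -tri0; apply: le_J; rewrite /A1 /A2 /A3; [solve_bmeas|solve_bmeas|].
  move=> x; apply: le_J; [solve_bmeas|solve_bmeas|].
  move=> y; apply: le_J; [solve_bmeas|solve_bmeas|].
  move=> z; rewrite -mulrDr -mulrBr ler_wpM2l ?mulr_ge0//.
  have [/andP[a0 a1] /andP[b0 b1]] := (F01 (x, z), F01 (y, z)).
  have /andP[c0 c1] := F01 (x, y).
  rewrite -subr_ge0.
  have -> : F (x, y) * F (y, z) * F (x, z) - (F (x, y) * F (x, z) +
     F (x, y) * F (y, z) - F (x, y)) =
     F (x, y) * ((1 - F (x, z)) * (1 - F (y, z))) by ring.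
  by rewrite !mulr_ge0// subr_ge0.
have sumE : (J_ x, J_ y, J_ z, A1 x y z + A2 x y z - A3 x y z) =
   (J_ x, J_ y, J_ z, A1 x y z) + (J_ x, J_ y, J_ z, A2 x y z)
     - (J_ x, J_ y, J_ z, A3 x y z).
  rewrite /A1 /A2 /A3 -JD; [|solve_bmeas|solve_bmeas].
  rewrite -JB; [|solve_bmeas|solve_bmeas].
  apply: eqJ => x; rewrite -JD; [|solve_bmeas|solve_bmeas].
  rewrite -JB; [|solve_bmeas|solve_bmeas].
  apply: eqJ => y; rewrite -JD; [|solve_bmeas|solve_bmeas].
  by rewrite -JB; [|solve_bmeas|solve_bmeas].
have aux (a b c m n : R) : a = m -> b = m -> c = n -> a + b - c <= 0 -> 2 * m <= n.
  by move=> -> -> ->; rewrite subr_le0 mulr_natl mulr2n.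
by apply: (aux _ _ _ _ _ E1 E2 E3); rewrite -sumE.
Qed.

(** Mantel's theorem with vertex masses [u]: the preceding lemma bounds the second moment of the
    degree from above, Cauchy-Schwarz from below. *)
Lemma mantel_kernel (u : T -> R) (F : T * T -> R) :
  bmeas u -> bmeas F -> (forall x, 0 <= u x) -> (forall z, 0 <= F z <= 1) ->
  (forall x y, F (x, y) = F (y, x)) ->
  (J_ x, J_ y, J_ z, u x * u y * u z * (F (x, y) * F (y, z) * F (x, z))) = 0 ->
  2 * (J_ x, J_ y, u x * u y * F (x, y)) <= (J u) ^+ 2.
Proof.
move=> bu bF u0 F01 Fsym tri0.
pose D := kernel_deg u F.
have bD : bmeas D by exact: bmeas_kernel_deg.
set N := J u; set t := (J_ x, _).
have N0 : 0 <= N by apply: J_ge0.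
have tE : t = J_ x, u x * D x by exact: kernel_degE.
have le1 : 2 * (J_ x, u x * D x ^+ 2) <= N * t by exact: triangle_free_degree_le.
(* Cauchy-Schwarz, as a mean of squares. With [le1] it gives [2 * N * t <= N ^+ 3], which is then
   divided by [N] unless [N = 0]. *)
have le2 : 0 <= 4 * (J_ x, u x * D x ^+ 2) - 4 * N * t + N ^+ 3.
  have -> : 4 * (J_ x, u x * D x ^+ 2) - 4 * N * t + N ^+ 3 =
      J_ x, u x * (2 * D x - N) ^+ 2.
    have -> : 4 * (J_ x, u x * D x ^+ 2) = J_ x, 4 * (u x * D x ^+ 2).
      by rewrite JZ//; solve_bmeas.
    have -> : 4 * N * t = J_ x, (4 * N) * (u x * D x).
      by rewrite JZ -?tE//; solve_bmeas.
    have -> : N ^+ 3 = J_ x, N ^+ 2 * u x by rewrite JZ// -exprSr.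
    rewrite -JB; [|solve_bmeas|solve_bmeas].
    rewrite -JD; [|solve_bmeas|solve_bmeas].
    by apply: eqJ => x; ring.
  by apply: J_ge0 => x; rewrite mulr_ge0// sqr_ge0.
have [N00|Npos] := eqVneq N 0; last first.
  have {}Npos : 0 < N by rewrite lt_neqAle eq_sym Npos.
  rewrite -(ler_pM2l Npos); rewrite exprSr in le2.
  have -> : N * N ^+ 2 = N ^+ 2 * N by ring.
  lra.
rewrite N00 expr0n /=.
have : t <= J_ x, J_ y, u x * u y.
  apply: le_J; [solve_bmeas|solve_bmeas|] => x.
  apply: le_J; [solve_bmeas|solve_bmeas|] => y.
  by rewrite ler_piMr ?mulr_ge0//; have /andP[] := F01 (x, y).
have -> : (J_ x, J_ y, u x * u y) = J_ x, u x * N.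
  by apply: eqJ => x; rewrite JZ.
rewrite N00; have -> : (J_ x, u x * 0) = 0.
  by under eq_Rintegral do rewrite mulr0; rewrite Jcst.
lra.
Qed.

(* Weighting the neighbourhood of [c] by [e ^ (-1/2)], where [e] is the degree
   in [E], makes the codegree bound cancel the weights; [eps] keeps the weights
   bounded. *)
Lemma claw_free_kernel_le (E F : T * T -> R) :
  bmeas E -> bmeas F ->
  (forall z, 0 <= E z <= 1) -> (forall z, 0 <= F z <= 1) ->
  (forall x y, E (x, y) = E (y, x)) -> (forall x y, F (x, y) = F (y, x)) ->
  (J_ c, J_ x, J_ y, J_ z, E (c, x) * E (c, y) * E (c, z) *
                           (F (x, y) * F (y, z) * F (x, z))) = 0 ->
  (J_ x, J_ y, E (x, y)) <= 2 * (1 - J_ x, J_ y, F (x, y)).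
Proof.
move=> bE bF E01 F01 Esym Fsym claw0.
pose e x := J_ y, E (x, y).
have be : bmeas e by rewrite /e; solve_bmeas.
have e0 x : 0 <= e x by apply: J_ge0 => y; have /andP[] := E01 (x, y).
have e1 x : e x <= 1.
  rewrite -[leRHS](Jcst P); apply: le_J; [|solve_bmeas|].
    by rewrite /e; solve_bmeas.
  by move=> y; have /andP[] := E01 (x, y).
apply/ler_addgt0Pr => eps eps0.
pose s x := Num.sqrt (e x + eps).
have s2 x : s x ^+ 2 = e x + eps by rewrite sqr_sqrtr// addr_ge0// ltW.
have s0 x : 0 < s x by rewrite sqrtr_gt0 ltr_wpDl.
have bs : bmeas s.
  split.
    have [mes _] : bmeas (fun x => e x + eps) by solve_bmeas.
    apply: measurableT_comp mes; apply: continuous_measurable_fun.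
    exact: sqrt_continuous.
  exists (Num.sqrt (1 + eps)) => x; rewrite ger0_norm; last exact: ltW.
  by apply: ler_wsqrtr; rewrite lerD2r.
pose w x := (s x)^-1.
have w0 x : 0 < w x by rewrite invr_gt0.
have bw : bmeas w.
  split.
    rewrite (_ : w = fun x => s x `^ (-1)).
      case: bs => ms _.
      exact: (@measurableT_comp _ _ _ _ _ _ (fun y : R => y `^ (-1)) setT s
        (measurable_powR (-1)) ms).
    by apply/funext => x; rewrite powR_inv1// ltW.
  exists (Num.sqrt eps)^-1 => x; rewrite gtr0_norm//.
  have le_s : Num.sqrt eps <= s x by apply: ler_wsqrtr; rewrite lerDr.
  by rewrite lef_pV2// posrE// sqrtr_gt0.
have sw x : s x * w x = 1 by rewrite divff// gt_eqF.
set JE := (J_ x, _).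
pose N c := J_ x, E (c, x) * w x.
have bN : bmeas N by rewrite /N; solve_bmeas.
(* For [c] of vanishing claw density, Mantel's theorem applies to [F] with masses [E (c, x) * w x];
   the other [c] form a null set. *)
have mantel : (J_ c, 2 * (J_ x, J_ y, (E (c, x) * w x) * (E (c, y) * w y) * F (x, y)))
   <= J_ c, N c ^+ 2.
  have [_ [M wM]] := bw.
  have M0 : 0 <= M by rewrite (le_trans _ (wM point)).
  have wM' x : w x <= M by rewrite (le_trans (ler_norm _)).
  have EF0 c x y z : 0 <= E (c, x) * E (c, y) * E (c, z) *
                           (F (x, y) * F (y, z) * F (x, z)).
    have E0 z' : 0 <= E z' by have /andP[] := E01 z'.
    have F0 z' : 0 <= F z' by have /andP[] := F01 z'.
    by rewrite !mulr_ge0.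
  apply: (le_J_on0 _ _ claw0).
  - solve_bmeas.
  - by move=> c; do 3! (apply: J_ge0 => ?); apply: EF0.
  - solve_bmeas.
  - solve_bmeas.
  move=> c hc; rewrite /N.
  have bu : bmeas (fun x => E (c, x) * w x) by solve_bmeas.
  have u0 x : 0 <= E (c, x) * w x.
    by rewrite mulr_ge0 ?(ltW (w0 x))//; have /andP[] := E01 (c, x).
  apply: (@mantel_kernel (fun x => E (c, x) * w x) F bu bF u0 F01 Fsym).
  apply/eqP; rewrite eq_le; apply/andP; split; last first.
    do 3! (apply: J_ge0 => ?).
    have E0 z' : 0 <= E z' by have /andP[] := E01 z'.
    have F0 z' : 0 <= F z' by have /andP[] := F01 z'.
    by rewrite !mulr_ge0// ltW.
  (* Since [w <= M], the weighted triangle mean is at most [M ^+ 3] times the unweighted one, which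
     vanishes at this [c]. *)
  rewrite -(mulr0 (M ^+ 3)) -hc -JZ; last by solve_bmeas.
  apply: le_J; [solve_bmeas|solve_bmeas|] => x.
  rewrite -JZ; last by solve_bmeas.
  apply: le_J; [solve_bmeas|solve_bmeas|] => y.
  rewrite -JZ; last by solve_bmeas.
  apply: le_J; [solve_bmeas|solve_bmeas|] => z.
  have -> : E (c, x) * w x * (E (c, y) * w y) * (E (c, z) * w z) *
      (F (x, y) * F (y, z) * F (x, z)) =
     w x * w y * w z * (E (c, x) * E (c, y) * E (c, z) * (F (x, y) * F (y, z) * F (x, z))) by ring.
  rewrite ler_wpM2r// !exprS expr0 mulr1 mulrA.
  by rewrite !ler_pM ?mulr_ge0 ?(ltW (w0 _)).
pose B z := 1 - F z.
have bB : bmeas B by rewrite /B; solve_bmeas.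
have B0 z : 0 <= B z by rewrite subr_ge0; have /andP[] := F01 z.
(* The codegree is at most [e x + eps] and at most [e y + eps], hence at most their geometric mean
   [s x * s y], which the weights cancel. *)
have codeg x y : (J_ c, E (c, x) * E (c, y)) * (w x * w y) <= 1.
  have h1 : (J_ c, E (c, x) * E (c, y)) <= s x * s y.
    have lex : (J_ c, E (c, x) * E (c, y)) <= e x + eps.
      apply: ler_wpDr; first exact: ltW.
      apply: le_J; [solve_bmeas|solve_bmeas|].
      move=> c; rewrite (Esym c x) ler_piMr//.
        by have /andP[] := E01 (x, c).
      by have /andP[] := E01 (c, y).
    have ley : (J_ c, E (c, x) * E (c, y)) <= e y + eps.
      apply: ler_wpDr; first exact: ltW.
      apply: le_J; [solve_bmeas|solve_bmeas|].
      move=> c; rewrite (Esym c y) ler_piMl//.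
        by have /andP[] := E01 (y, c).
      by have /andP[] := E01 (c, x).
    have k0 : 0 <= (J_ c, E (c, x) * E (c, y)).
      apply: J_ge0 => c.
      by have [/andP[? _] /andP[? _]] := (E01 (c, x), E01 (c, y)); rewrite mulr_ge0.
    have : (J_ c, E (c, x) * E (c, y)) ^+ 2 <= (s x * s y) ^+ 2.
      by rewrite exprMn !s2 expr2 ler_pM.
    by rewrite ler_pXn2r// nnegrE mulr_ge0 ?(ltW (s0 _)).
  rewrite (le_trans (ler_wpM2r _ h1)) ?mulr_ge0 ?(ltW (w0 _))//.
  by rewrite mulrACA !sw mulr1.
(* Integrating over [c] first turns the two factors [E] into the codegree of [x] and [y]. *)
have black : (J_ c, J_ x, J_ y, (E (c, x) * w x) * (E (c, y) * w y) * B (x, y))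
   <= J_ x, J_ y, B (x, y).
  rewrite (@Jswap _ _ _ P (fun z => J_ y, E (z.1, z.2) * w z.2 * (E (z.1, y) * w y) * B (z.2, y)));
    last by solve_bmeas.
  apply: le_J; [solve_bmeas|solve_bmeas|] => x /=.
  rewrite (@Jswap _ _ _ P (fun z => E (z.1, x) * w x * (E (z.1, z.2) * w z.2) * B (x, z.2)));
    last by solve_bmeas.
  apply: le_J; [solve_bmeas|solve_bmeas|] => y /=.
  have -> : (J_ c, E (c, x) * w x * (E (c, y) * w y) * B (x, y)) =
      (J_ c, E (c, x) * E (c, y)) * (w x * w y) * B (x, y).
    rewrite -mulrA -JZr; last by solve_bmeas.
    by apply: eqJ => c; ring.
  by rewrite ler_piMl.
(* From [N ^+ 2 >= 2 * N * s - s ^+ 2]: the mean of [N * s] is at least [JE], and that of [s ^+ 2]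
   is [JE + eps]. *)
have lower : JE - eps <= J_ c, N c ^+ 2.
  have h1 : JE <= J_ c, N c * s c.
    (* Exchanging the ends of an edge exchanges [s] and [w]. The two forms are added, and AM-GM
       applies because [w x * s c] and [s x * w c] are inverse to each other. *)
    have sym : (J_ c, N c * s c) = J_ c, J_ x, E (c, x) * (s x * w c).
      have -> : (J_ c, N c * s c) = J_ c, J_ x, E (c, x) * (w x * s c).
        apply: eqJ => c; rewrite /N -JZr; last by solve_bmeas.
        by apply: eqJ => x; ring.
      rewrite (@Jswap _ _ _ P (fun z => E (z.1, z.2) * (w z.2 * s z.1)));
        last by solve_bmeas.
      by apply: eqJ => x; apply: eqJ => y /=; rewrite (Esym y x) [w x * _]mulrC.
    have : 2 * JE <= (J_ c, N c * s c) + (J_ c, N c * s c).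
      rewrite {2}sym -JZ; last by solve_bmeas.
      rewrite -JD; [|solve_bmeas|solve_bmeas].
      apply: le_J; [solve_bmeas|solve_bmeas|] => c.
      rewrite /N -JZr; last by solve_bmeas.
      rewrite -JZ; last by solve_bmeas.
      rewrite -JD; [|solve_bmeas|solve_bmeas].
      apply: le_J; [solve_bmeas|solve_bmeas|] => x.
      have -> : E (c, x) * w x * s c + E (c, x) * (s x * w c) =
        (w x * s c + s x * w c) * E (c, x) by ring.
      rewrite ler_wpM2r//; first by have /andP[] := E01 (c, x).
      have -> : w x * s c + s x * w c =
        (s c - s x) ^+ 2 * (w x * w c) +
        (2 * (s x * w x) * (s c * w c) - (s x * w x - 1) * (s x * w c)
          - (s c * w c - 1) * (s c * w x)) by ring.
      rewrite !sw subrr !mul0r !subr0 !mulr1 lerDr.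
      apply: mulr_ge0; first exact: sqr_ge0.
      by rewrite mulr_ge0 ?(ltW (w0 _)).
    have aux : forall a b : R, 2 * a <= b + b -> a <= b by clear; move=> a b; lra.
    exact: aux.
  have h2 : (J_ c, s c ^+ 2) = JE + eps.
    rewrite -(Jcst P eps) -JD; [|solve_bmeas|solve_bmeas].
    by apply: eqJ => c; rewrite s2.
  have h3 : 2 * (J_ c, N c * s c) - (J_ c, s c ^+ 2) <= J_ c, N c ^+ 2.
    rewrite -JZ; last by solve_bmeas.
    rewrite -JB; [|solve_bmeas|solve_bmeas].
    apply: le_J; [solve_bmeas|solve_bmeas|] => c.
    by rewrite -subr_ge0 (_ : _ - _ = (N c - s c) ^+ 2) ?sqr_ge0//; ring.
  have aux : forall a X S Q : R, a <= X -> S = a + eps -> 2 * X - S <= Q -> a - eps <= Q.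
    by clear; move=> *; lra.
  exact: aux h1 h2 h3.
(* Since [F + B = 1], the squared mass splits into non-black and black pairs, and [mantel] leaves at
   most half of it to the former. *)
have split_ : (J_ c, N c ^+ 2) =
   (J_ c, J_ x, J_ y, (E (c, x) * w x) * (E (c, y) * w y) * F (x, y)) +
   (J_ c, J_ x, J_ y, (E (c, x) * w x) * (E (c, y) * w y) * B (x, y)).
  rewrite -JD; [|solve_bmeas|solve_bmeas].
  apply: eqJ => c; rewrite -JD; [|solve_bmeas|solve_bmeas].
  rewrite expr2 {1}/N -JZr; last by solve_bmeas.
  apply: eqJ => x; rewrite -JD; [|solve_bmeas|solve_bmeas].
  rewrite -JZ; last by solve_bmeas.
  by apply: eqJ => y; rewrite /B; ring.
have BE : (J_ x, J_ y, B (x, y)) = 1 - J_ x, J_ y, F (x, y).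
  rewrite -[X in X - _](Jcst P) -JB; [|solve_bmeas|solve_bmeas].
  apply: eqJ => x; rewrite -[X in X - _](Jcst P) -JB; [|solve_bmeas|solve_bmeas].
  by [].
rewrite JZ in mantel; last by solve_bmeas.
have aux : forall a b k m q : R, 2 * m <= q -> q = m + k -> k <= b -> a - eps <= q ->
    a <= 2 * b + eps by clear; move=> *; lra.
by rewrite -BE; exact: aux mantel split_ black lower.
Qed.

End kernels.

(** * Kernels attaining equality *)

Section extremal_kernels.
Context (R : realType) d (T : measurableType d) (P : probability T R).

Local Notation "'J_' x , f" := (Rintegral P setT (fun x => f))
  (at level 200, x name, f at level 200, only parsing).
Local Notation J := (Rintegral P setT).

(** A typical [c] has vanishing claw density and is joined by [E] to almost every point, so
    triangles of [F] are claws at [c] up to the deficits [1 - E (c, x)]. *)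
Lemma full_claw_free_triangle_free (E F : T * T -> R) :
  bmeas E -> bmeas F ->
  (forall z, 0 <= E z <= 1) -> (forall z, 0 <= F z <= 1) ->
  (J_ x, J_ y, E (x, y)) = 1 ->
  (J_ c, J_ x, J_ y, J_ z, E (c, x) * E (c, y) * E (c, z) *
                           (F (x, y) * F (y, z) * F (x, z))) = 0 ->
  (J_ x, J_ y, J_ z, F (x, y) * F (y, z) * F (x, z)) = 0.
Proof.
move=> bE bF E01 F01 JE claw0.
have E0 z : 0 <= E z by have /andP[] := E01 z.
have F0 z : 0 <= F z by have /andP[] := F01 z.
have E1 z : 0 <= 1 - E z by rewrite subr_ge0; have /andP[] := E01 z.
pose claw c := J_ x, J_ y, J_ z, E (c, x) * E (c, y) * E (c, z) *
                           (F (x, y) * F (y, z) * F (x, z)).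
have claw_ge0 c : 0 <= claw c by do 3! (apply: J_ge0 => ?); rewrite !mulr_ge0.
have bclaw : bmeas claw by rewrite /claw; solve_bmeas.
pose miss c := J_ x, 1 - E (c, x).
have miss_ge0 c : 0 <= miss c by apply: J_ge0.
have bmiss : bmeas miss by rewrite /miss; solve_bmeas.
have Jmiss : J miss = 0.
  transitivity (J_ c, 1 - J_ x, E (c, x)).
    apply: eqJ => c; rewrite -[X in _ = X - _](Jcst P) -JB //; solve_bmeas.
  by rewrite JB ?JE ?Jcst ?subrr//; solve_bmeas.
have [c /eqP] : exists c, claw c + miss c = 0.
  apply: J_eq0_ex; [solve_bmeas|by move=> c; rewrite addr_ge0|].
  have Jclaw : J claw = 0 by exact: claw0.
  by transitivity (J claw + J miss); [exact: JD|rewrite Jclaw Jmiss addr0].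
rewrite (paddr_eq0 (claw_ge0 c) (miss_ge0 c)) => /andP[/eqP clawc /eqP missc].
rewrite /claw in clawc; rewrite /miss in missc.
apply/eqP; rewrite eq_le; apply/andP; split; last first.
  by do 3! (apply: J_ge0 => ?); rewrite !mulr_ge0.
(* Zero is written as the mean of a pointwise upper bound for the triangle integrand: a claw at [c]
   plus the deficits of its three edges. *)
have -> : (0 : R) = J_ x, J_ y, J_ z, E (c, x) * E (c, y) * E (c, z) *
    (F (x, y) * F (y, z) * F (x, z)) + (1 - E (c, x) + (1 - E (c, y)) + (1 - E (c, z))).
  transitivity (J_ x, (J_ y, J_ z, E (c, x) * E (c, y) * E (c, z) *
    (F (x, y) * F (y, z) * F (x, z))) + (1 - E (c, x))).
    by rewrite JD; [rewrite missc clawc addr0|solve_bmeas|solve_bmeas].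
  apply: eqJ => x.
  transitivity (J_ y, (J_ z, E (c, x) * E (c, y) * E (c, z) *
    (F (x, y) * F (y, z) * F (x, z))) + (1 - E (c, x) + (1 - E (c, y)))).
    rewrite JD; [|solve_bmeas|solve_bmeas]; congr (_ + _).
    by rewrite JD; [rewrite missc Jcst addr0|solve_bmeas|solve_bmeas].
  apply: eqJ => y.
  rewrite JD; [|solve_bmeas|solve_bmeas]; congr (_ + _).
  by rewrite JD; [rewrite missc Jcst addr0|solve_bmeas|solve_bmeas].
apply: le_J; [solve_bmeas|solve_bmeas|] => x.
apply: le_J; [solve_bmeas|solve_bmeas|] => y.
apply: le_J; [solve_bmeas|solve_bmeas|] => z.
have F3 : F (x, y) * F (y, z) * F (x, z) <= 1.
  by rewrite !mulr_ile1 ?mulr_ge0//; [have /andP[] := F01 (x, y)|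
    have /andP[] := F01 (y, z)|have /andP[] := F01 (x, z)].
have F30 : 0 <= F (x, y) * F (y, z) * F (x, z) by rewrite !mulr_ge0.
move: F3 F30 (E1 (c, x)) (E1 (c, y)) (E1 (c, z)) (E0 (c, x)) (E0 (c, y)) (E0 (c, z)).
move: (_ * _ * F (x, z)) (E (c, x)) (E (c, y)) (E (c, z)) => f a b g f1 f0 a1 b1 g1 a0 b0 g0.
have ab0 : 0 <= a * b by rewrite mulr_ge0.
have h1 : 0 <= (1 - a) * (1 - b) by rewrite mulr_ge0.
have ab1 : a * b <= 1 by rewrite mulr_ile1// -subr_ge0.
have h2 : 0 <= (1 - a * b) * (1 - g) by rewrite mulr_ge0// subr_ge0.
have h3 : 0 <= (1 - f) * (1 - a * b * g).
  by rewrite mulr_ge0// subr_ge0// mulr_ile1// -subr_ge0.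
by move: h1 h2 h3; clear; move=> *; lra.
Qed.

(** The complete bipartite graph between [A] and its complement, as a polynomial in the indicators,
    so that its means expand linearly. *)
Definition cut_kernel (A : set T) (z : T * T) : R :=
  \1_A z.1 + \1_A z.2 - 2 * (\1_A z.1 * \1_A z.2).

(* Equality in Mantel's theorem: all degrees are 1/2, and [A] is the
   neighbourhood of a typical point. *)
Lemma mantel_kernel_extremal (F : T * T -> R) :
  bmeas F -> (forall z, F z = 0 \/ F z = 1) ->
  (forall x y, F (x, y) = F (y, x)) ->
  (J_ x, J_ y, F (x, y)) = 1 / 2 ->
  (J_ x, J_ y, J_ z, F (x, y) * F (y, z) * F (x, z)) = 0 ->
  exists A, [/\ measurable A, J \1_A = 1 / 2 &
    (J_ x, J_ y, (F (x, y) - cut_kernel A (x, y)) ^+ 2) = 0].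
Proof.
have q14 : (1 / 2) * (1 / 2) = 1 / 4 :> R by lra.
have q11 : 1 / 2 + 1 / 2 = 1 :> R by lra.
(* The means of the terms in the expanded squared distance cancel. *)
have q0 : 1 / 2 + (1 + (-2 * (1 / 4) + (-2 * (1 / 4) + (-2 * (1 / 4) + 4 * 0)))) = 0 :> R.
  by lra.
move=> bF F2 Fsym JF tri0.
have F0 z : 0 <= F z by case: (F2 z) => ->.
have F01 z : 0 <= F z <= 1 by case: (F2 z) => ->; rewrite ?lexx ?ler01.
have FF z : F z * F z = F z by case: (F2 z) => ->; rewrite ?mulr0 ?mulr1.
pose D x := J_ y, F (x, y).
have bD : bmeas D by rewrite /D; solve_bmeas.
have DE : kernel_deg P (fun=> 1) F = D.
  by apply/funext => x; apply: eqJ => y; rewrite mul1r.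
have JD2 : 2 * (J_ x, D x ^+ 2) <= 1 / 2.
  have t1 : (J_ x, J_ y, J_ z, 1 * 1 * 1 * (F (x, y) * F (y, z) * F (x, z))) = 0.
    by rewrite -tri0; do 3! (apply: eqJ => ?); rewrite !mul1r.
  have t2 : (J_ x, J_ y, 1 * 1 * F (x, y)) = 1 / 2.
    by rewrite -JF; do 2! (apply: eqJ => ?); rewrite !mul1r.
  have t3 : (J_ x, D x ^+ 2) = (J_ x, 1 * D x ^+ 2).
    by apply: eqJ => x; rewrite mul1r.
  have := @triangle_free_degree_le _ _ _ P (fun=> 1) F (bmeas_cst _ 1) bF
    (fun=> ler01) F01 Fsym t1.
  by rewrite t2 DE Jcst -t3 (mul1r (1 / 2)).
(* [h] vanishes exactly at the points of degree 1/2; [JD2] makes its mean at most 0. *)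
pose h x := (2 * D x - 1) ^+ 2.
have bh : bmeas h by rewrite /h; solve_bmeas.
have h0 x : 0 <= h x by rewrite sqr_ge0.
have Jh : J h = 0.
  apply/eqP; rewrite eq_le; apply/andP; split; last exact: J_ge0.
  have -> : J h = 4 * (J_ x, D x ^+ 2) - 4 * J D + 1.
    rewrite -[X in _ + X](Jcst P) -JZ; last by solve_bmeas.
    rewrite -JZ; last by solve_bmeas.
    rewrite -JB; [|solve_bmeas|solve_bmeas].
    rewrite -JD; [|solve_bmeas|solve_bmeas].
    by apply: eqJ => x; rewrite /h; ring.
  have JD1 : J D = 1 / 2 by exact: JF.
  have aux : forall t : R, 2 * t <= 1 / 2 -> 4 * t - 4 * (1 / 2) + 1 <= 0.
    by clear; move=> *; lra.
  by rewrite JD1; exact: aux.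
have hD x : h x = 0 -> D x = 1 / 2.
  have aux : forall t : R, 2 * t - 1 = 0 -> t = 1 / 2 by clear; move=> *; lra.
  by move/eqP; rewrite sqrf_eq0 => /eqP /aux.
pose tri x := J_ y, J_ z, F (x, y) * F (y, z) * F (x, z).
have btri : bmeas tri by rewrite /tri; solve_bmeas.
have tri_ge0 x : 0 <= tri x by do 2! (apply: J_ge0 => ?); rewrite !mulr_ge0.
(* [x0] has degree 1/2 and triangle density 0, so its neighbourhood has measure 1/2 and spans almost
   no edges. *)
have [x0 /eqP] : exists x, h x + tri x = 0.
  apply: J_eq0_ex; [solve_bmeas|by move=> x; rewrite addr_ge0|].
  have Jtri : J tri = 0 by exact: tri0.
  by transitivity (J h + J tri); [exact: JD|rewrite Jtri Jh addr0].
rewrite (paddr_eq0 (h0 x0) (tri_ge0 x0)) => /andP[/eqP hx0 /eqP trix0].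
pose A : set T := [set y | F (x0, y) = 1].
have mA : measurable A.
  have -> : A = (fun y => F (x0, y)) @^-1` [set 1] by [].
  rewrite -[X in measurable X]setTI.
  have [mFx _] : bmeas (fun y => F (x0, y)) by solve_bmeas.
  exact: mFx.
have AE y : \1_A y = F (x0, y) :> R.
  rewrite indicE; case: (F2 (x0, y)) => Fy.
    have nA : ~ A y by rewrite /A /= Fy => /esym/eqP; rewrite oner_eq0.
    by rewrite (memNset nA) Fy.
  by rewrite (@mem_set _ A y Fy) Fy.
pose a : T -> R := \1_A.
have ba : bmeas a by exact: bmeas_indic.
have aE y : a y = F (x0, y) by exact: AE.
have aa y : a y * a y = a y by rewrite aE FF.
have Ja : J a = 1 / 2 by rewrite (eqJ P aE); exact: hD.
exists A; split; [exact: mA|exact: Ja|].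
have q1 : (J_ x, J_ y, a x * F (x, y)) = 1 / 4.
  transitivity (J_ x, a x * (1 / 2)).
    apply: (eq_J_on0 bh h0 Jh); [solve_bmeas|solve_bmeas|].
    by move=> x /hD <-; rewrite JZ; [|solve_bmeas].
  by rewrite (JZr P (1 / 2) ba) Ja q14.
have q2 : (J_ x, J_ y, a y * F (x, y)) = 1 / 4.
  rewrite (@Jswap _ _ _ P (fun z => a z.2 * F z))/=; last first.
    apply: (@bmeasM _ _ _ (fun z : T * T => a z.2) F) => //; solve_bmeas.
  by rewrite -q1; apply: eqJ => x; apply: eqJ => y; rewrite Fsym.
have q3 : (J_ x, J_ y, a x * a y * F (x, y)) = 0.
  by rewrite -trix0; apply: eqJ => x; apply: eqJ => y; rewrite !aE; ring.
have q4 : (J_ x, J_ y, a x * a y) = 1 / 4.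
  transitivity (J_ x, a x * (1 / 2)).
    by apply: eqJ => x; rewrite (JZ P (a x) ba) Ja.
  by rewrite (JZr P (1 / 2) ba) Ja q14.
have q5 : (J_ x, J_ y, a x + a y) = 1.
  transitivity (J_ x, a x + 1 / 2).
    apply: eqJ => x; rewrite (JD P (bmeas_cst _ (a x)) ba).
    by rewrite (Jcst P (a x)) Ja.
  by rewrite (JD P ba (bmeas_cst _ (1 / 2))) (Jcst P (1 / 2)) Ja q11.
(* Because [F] and [a] are idempotent, the squared distance is a linear combination of [F] and the
   terms whose means are [q1] to [q5]. *)
transitivity (J_ x, J_ y, F (x, y) + ((a x + a y) +
   ((-2) * (a x * a y) + ((-2) * (a x * F (x, y)) + ((-2) * (a y * F (x, y)) +
     4 * (a x * a y * F (x, y))))))).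
  apply: eqJ => x; apply: eqJ => y; rewrite /cut_kernel /=.
  have e1 := FF (x, y); have e2 := aa x; have e3 := aa y.
  rewrite -[\1_A x]/(a x) -[\1_A y]/(a y).
  move: (F _) (a x) (a y) e1 e2 e3 => f b c ff bb cc.
  have -> : (f - (b + c - 2 * (b * c))) ^+ 2 = f * f + (b * b + c * c + 2 * (b * c)
    - 4 * (b * b * c) - 4 * (b * (c * c)) + 4 * ((b * b) * (c * c)))
    - 2 * (f * b) - 2 * (f * c) + 4 * (f * b * c) by ring.
  by rewrite ff bb cc; ring.
have lin (f g : T * T -> R) c e : bmeas f -> bmeas g -> (J_ x, J_ y, f (x, y)) = c ->
    (J_ x, J_ y, g (x, y)) = e -> (J_ x, J_ y, f (x, y) + g (x, y)) = c + e.
  move=> bf bg <- <-; rewrite -JD; [|solve_bmeas|solve_bmeas].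
  by apply: eqJ => x; rewrite -JD; [|solve_bmeas|solve_bmeas].
have scal (f : T * T -> R) k c : bmeas f -> (J_ x, J_ y, f (x, y)) = c ->
    (J_ x, J_ y, k * f (x, y)) = k * c.
  move=> bf <-; rewrite -JZ; last by solve_bmeas.
  by apply: eqJ => x; rewrite -JZ; [|solve_bmeas].
pose g1 (z : T * T) := a z.1 + a z.2.
pose g2 (z : T * T) := a z.1 * a z.2.
pose g3 (z : T * T) := a z.1 * F (z.1, z.2).
pose g4 (z : T * T) := a z.2 * F (z.1, z.2).
pose g5 (z : T * T) := a z.1 * a z.2 * F (z.1, z.2).
have b1 : bmeas g1 by rewrite /g1; solve_bmeas.
have b2 : bmeas g2 by rewrite /g2; solve_bmeas.
have b3 : bmeas g3 by rewrite /g3; solve_bmeas.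
have b4 : bmeas g4 by rewrite /g4; solve_bmeas.
have b5 : bmeas g5 by rewrite /g5; solve_bmeas.
have s2 := scal g2 (-2) _ b2 q4.
have s3 := scal g3 (-2) _ b3 q1.
have s4 := scal g4 (-2) _ b4 q2.
have s5 := scal g5 4 _ b5 q3.
have c2 : bmeas (fun z => (-2) * g2 z) by exact: (bmeasM (bmeas_cst _ _)).
have c3 : bmeas (fun z => (-2) * g3 z) by exact: (bmeasM (bmeas_cst _ _)).
have c4 : bmeas (fun z => (-2) * g4 z) by exact: (bmeasM (bmeas_cst _ _)).
have c5 : bmeas (fun z => 4 * g5 z) by exact: (bmeasM (bmeas_cst _ _)).
have t4 := lin _ _ _ _ c4 c5 s4 s5; have d4 := bmeasD c4 c5.
have t3 := lin _ _ _ _ c3 d4 s3 t4; have d3 := bmeasD c3 d4.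
have t2 := lin _ _ _ _ c2 d3 s2 t3; have d2 := bmeasD c2 d3.
have t1 := lin _ _ _ _ b1 d2 q5 t2; have d1 := bmeasD b1 d2.
by rewrite (lin _ _ _ _ bF d1 JF t1) q0.
Qed.

End extremal_kernels.
Arguments cut_kernel {R d T} A z.

(** * Integration over the cube *)

Section iterated_mean.
Context (R : realType) d (T : measurableType d) (P : probability T R).

Local Notation "'J_' x , f" := (Rintegral P setT (fun x => f))
  (at level 200, x name, f at level 200, only parsing).
Local Notation J := (Rintegral P setT).

(** Recursion on the head mirrors [lebesgue_tuple], and lets the one-variable lemmas be applied
    coordinate by coordinate. *)
Fixpoint iterJ n : (n.-tuple T -> R) -> R :=
  match n with
  | 0 => fun f => f [tuple]
  | n'.+1 => fun f => J_ x, iterJ (fun t => f [tuple of x :: t])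
  end.
Arguments iterJ n f : clear implicits.

Lemma measurable_consT n d' (T' : measurableType d') (g : T' -> T)
    (h : T' -> n.-tuple T) :
  measurable_fun setT g -> measurable_fun setT h ->
  measurable_fun setT (fun z => [tuple of g z :: h z]).
Proof. by move=> mg mh; exact: measurable_cons. Qed.

Lemma bmeas_cons n (f : n.+1.-tuple T -> R) (x : T) : bmeas f ->
  bmeas (fun t : n.-tuple T => f [tuple of x :: t]).
Proof.
move=> bf; apply: bmeas_comp => //.
by apply: measurable_consT; [exact: measurable_cst|exact: measurable_id].
Qed.

(** The parameter space is generalized in the induction, because each step moves the head of the
    tuple into the parameter. *)
Lemma bmeas_iterJ n d' (T' : measurableType d') (f : T' * n.-tuple T -> R) :
  bmeas f -> bmeas (fun x => iterJ n (fun t => f (x, t))).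
Proof.
elim: n d' T' f => [|n IHn] d' T' f bf /=.
  by apply: bmeas_comp => //; exact: measurable_pair2.
apply: (@bmeas_J _ _ _ P _ _
  (fun z => iterJ n (fun t => f (z.1, [tuple of z.2 :: t])))).
apply: (IHn _ _ (fun w : (T' * T) * n.-tuple T => f (w.1.1, [tuple of w.1.2 :: w.2]))).
apply: (@bmeas_comp _ _ _ _ _ f
  (fun w : (T' * T) * n.-tuple T => (w.1.1, [tuple of w.1.2 :: w.2]))) => //.
apply: measurable_fun_pair; first by solve_measurable.
by apply: measurable_consT; solve_measurable.
Qed.

Lemma bmeas_iterJ_cons n (f : n.+1.-tuple T -> R) : bmeas f ->
  bmeas (fun x => iterJ n (fun t => f [tuple of x :: t])).
Proof.
move=> bf; apply: (@bmeas_iterJ n _ _ (fun w => f [tuple of w.1 :: w.2])).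
apply: (@bmeas_comp _ _ _ _ _ f (fun w : T * n.-tuple T => [tuple of w.1 :: w.2])) => //.
by apply: measurable_consT; solve_measurable.
Qed.

Lemma bmeas_tnth2 n i j (f : T * T -> R) : bmeas f ->
  bmeas (fun t : n.-tuple T => f (tnth t i, tnth t j)).
Proof.
move=> bf; apply: (@bmeas_comp _ _ _ _ _ f
  (fun t : n.-tuple T => (tnth t i, tnth t j))) => //.
by apply: measurable_fun_pair; exact: measurable_tnth.
Qed.

Lemma eq_iterJ n (f g : n.-tuple T -> R) : f =1 g -> iterJ n f = iterJ n g.
Proof. by move=> /funext ->. Qed.

Lemma iterJ_cst n c : iterJ n (fun=> c) = c.
Proof. by elim: n => //= n ->; rewrite Jcst. Qed.

Lemma iterJ_ge0 n (f : n.-tuple T -> R) : (forall t, 0 <= f t) -> 0 <= iterJ n f.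
Proof. by elim: n f => //= n IHn f f0; apply: J_ge0 => x; exact: IHn. Qed.

Lemma iterJD n (f g : n.-tuple T -> R) : bmeas f -> bmeas g ->
  iterJ n (fun t => f t + g t) = iterJ n f + iterJ n g.
Proof.
elim: n f g => //= n IHn f g bf bg; rewrite -JD; [|exact: bmeas_iterJ_cons..].
by apply: eqJ => x; rewrite IHn//; exact: bmeas_cons.
Qed.

Lemma bmeas_prod n (I : Type) (s : seq I) (Q : pred I) (f : I -> n.-tuple T -> R) :
  (forall i, bmeas (f i)) -> bmeas (fun t => \prod_(i <- s | Q i) f i t).
Proof.
move=> bf; elim: s => [|k s' IHs].
  by rewrite (_ : (fun _ => _) = fun=> 1); [exact: bmeas_cst|apply/funext => t; rewrite big_nil].
rewrite (_ : (fun _ => _) = fun t => (if Q k then f k t else 1) * \prod_(i <- s' | Q i) f i t).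
  by apply: bmeasM => //; case: (Q k); [exact: bf|exact: bmeas_cst].
by apply/funext => t; rewrite big_cons; case: ifP => //; rewrite mul1r.
Qed.

Lemma bmeas_sum n (I : Type) (s : seq I) (Q : pred I) (f : I -> n.-tuple T -> R) :
  (forall i, bmeas (f i)) -> bmeas (fun t => \sum_(i <- s | Q i) f i t).
Proof.
move=> bf; elim: s => [|k s' IHs].
  by rewrite (_ : (fun _ => _) = fun=> 0); [exact: bmeas_cst|apply/funext => t; rewrite big_nil].
rewrite (_ : (fun _ => _) = fun t => (if Q k then f k t else 0) + \sum_(i <- s' | Q i) f i t).
  by apply: bmeasD => //; case: (Q k); [exact: bf|exact: bmeas_cst].
by apply/funext => t; rewrite big_cons; case: ifP => //; rewrite add0r.
Qed.

Lemma iterJ_sum n (I : Type) (s : seq I) (Q : pred I) (f : I -> n.-tuple T -> R) :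
  (forall i, bmeas (f i)) ->
  iterJ n (fun t => \sum_(i <- s | Q i) f i t) = \sum_(i <- s | Q i) iterJ n (f i).
Proof.
move=> bf; elim: s => [|i s IHs].
  by rewrite big_nil (eq_iterJ (g := fun=> 0)) ?iterJ_cst// => t; rewrite big_nil.
rewrite big_cons -IHs; case: ifPn => Qi; last first.
  by apply: eq_iterJ => t; rewrite big_cons (negbTE Qi).
rewrite -iterJD//; last exact: bmeas_sum.
by apply: eq_iterJ => t; rewrite big_cons Qi.
Qed.

(** A nonnegative [h] of mean zero has sections of mean zero at almost every head, and the induction
    hypothesis applies to those. *)
Lemma eq_iterJ_on0 n (h f g : n.-tuple T -> R) : bmeas h -> (forall t, 0 <= h t) ->
  iterJ n h = 0 -> bmeas f -> bmeas g -> (forall t, h t = 0 -> f t = g t) ->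
  iterJ n f = iterJ n g.
Proof.
elim: n h f g => /= [|n IHn] h f g bh h0 Jh bf bg fg; first exact: fg.
apply: (eq_J_on0 (bmeas_iterJ_cons bh) _ Jh); [|exact: bmeas_iterJ_cons..|].
  by move=> x; exact: iterJ_ge0.
move=> x hx; apply: (IHn _ _ _ (bmeas_cons x bh)) => //; try exact: bmeas_cons.
by move=> t; exact: fg.
Qed.

Lemma iterJ_tnth n (i : 'I_n) (f : T -> R) :
  iterJ n (fun t => f (tnth t i)) = J f.
Proof.
elim: n i => [[]//|n IHn i] /=; case: (unliftP ord0 i) => [j|] ->.
  rewrite -[RHS](Jcst P); apply: eqJ => x; rewrite -(IHn j).
  by apply: eq_iterJ => t; rewrite tnthS.
by apply: eqJ => x; rewrite -[RHS](iterJ_cst n).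
Qed.

Lemma iterJ_tnth2 n (i j : 'I_n) (f : T * T -> R) : (i < j)%N ->
  iterJ n (fun t => f (tnth t i, tnth t j)) = J_ x, J_ y, f (x, y).
Proof.
elim: n i j => [[]//|n IHn i j] /=.
case: (unliftP ord0 j) => [j'|] -> //; case: (unliftP ord0 i) => [i'|] -> ij.
  rewrite -[RHS](Jcst P); apply: eqJ => x; rewrite -(IHn i' j')//.
  by apply: eq_iterJ => t; rewrite !tnthS.
apply: eqJ => x; rewrite -(iterJ_tnth j').
by apply: eq_iterJ => t; rewrite tnthS.
Qed.

End iterated_mean.
Arguments iterJ {R d T} P n f.

(** The indicators of the coordinates are independent, with a law fixed by the measure of the set.
    In the induction the mean over the tail is affine in the indicator of the head, with values
    [g A 0] and [g A 1]. *)
Lemma iterJ_indic_law (R : realType) d (T : measurableType d) (P : probability T R)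
    n (A1 A2 : set T) (G : n.-tuple R -> R) :
  measurable A1 -> measurable A2 ->
  Rintegral P setT \1_A1 = Rintegral P setT \1_A2 ->
  iterJ P n (fun t => G (map_tuple \1_A1 t)) = iterJ P n (fun t => G (map_tuple \1_A2 t)).
Proof.
move=> mA1 mA2 A12; elim: n G => /= [|n IHn] G.
  by congr G; exact: val_inj.
pose g A c := iterJ P n (fun t => G [tuple of c :: map_tuple \1_A t]).
have split_ A : measurable A ->
    Rintegral P setT (fun x => iterJ P n (fun t => G (map_tuple \1_A [tuple of x :: t]))) =
    (g A 1 - g A 0) * Rintegral P setT \1_A + g A 0.
  move=> mA; rewrite -(Jcst P (g A 0)) -JZ; last exact: bmeas_indic.
  rewrite -JD; [|by apply: bmeasM; [exact: bmeas_cst|exact: bmeas_indic]|exact: bmeas_cst].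
  apply: eqJ => x; rewrite Jcst.
  have -> : iterJ P n (fun t => G (map_tuple \1_A [tuple of x :: t])) = g A (\1_A x).
    by apply: eq_iterJ => t; congr G; exact: val_inj.
  by rewrite indicE; case: (x \in A); rewrite /= ?mulr1 ?mulr0 ?subrK ?add0r.
have gE c : g A1 c = g A2 c by exact: (IHn (fun t => G [tuple of c :: t])).
by rewrite (split_ _ mA1) (split_ _ mA2) A12 !gE.
Qed.

(** * Lebesgue integrals over the unit cube and graphon densities as iterated means *)

Section unit_interval.
Context (R : realType).
Local Notation mR := (measurableTypeR R).
Local Notation mu := (@lebesgue_measure R).
Local Notation I := (@unit_itv R).

(** Lebesgue measure on the unit interval, seen as a probability on the whole line, so that means
    need no domain of integration. *)
Definition unit_prob : probability mR R := uniform_prob (@ltr01 R).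
Local Notation U := unit_prob.

Local Notation "'J_' x , f" := (Rintegral U setT (fun x => f))
  (at level 200, x name, f at level 200, only parsing).
Local Notation J := (Rintegral U setT).

Lemma measurable_unit_itv : measurable I.
Proof. exact: measurable_itv. Qed.

Lemma unit_prob_integral (f : mR -> \bar R) :
  measurable_fun setT f -> (forall x, 0 <= f x)%E ->
  (\int[U]_x f x = \int[mu]_(x in I) f x)%E.
Proof. by move=> mf f0; rewrite [LHS]integral_uniform// subr0 invr1 mul1e. Qed.

Lemma measurable_cube n : measurable (@cube R n).
Proof.
have -> : @cube R n = \bigcap_(i in [set: 'I_n]) ((fun t => tnth t i) @^-1` I).
  by apply/seteqP; split => t /= h i; [move=> _; exact: h|exact: h].
apply: fin_bigcap_measurable => [|i _]; first exact: finite_finset.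
rewrite -[X in measurable X]setTI; apply: measurable_tnth => //.
exact: measurable_unit_itv.
Qed.

(** The pushforward formula along [cons_pair] and Tonelli's theorem split off the head. Domains are
    first turned into extensions by zero, so that both apply on the full space. *)
Lemma integral_cubeS n (f : n.+1.-tuple mR -> \bar R) :
  measurable_fun setT f -> (forall t, 0 <= f t)%E ->
  (\int[lebesgue_tuple R n.+1]_(t in @cube R n.+1) f t =
   \int[U]_x \int[lebesgue_tuple R n]_(t in @cube R n) f [tuple of x :: t])%E.
Proof.
move=> mf f0.
pose l : {sigma_finite_measure set (n.-tuple mR) -> \bar R} := lebesgue_tuple R n.
pose g := (f \_ (@cube R n.+1))%E.
have mg : measurable_fun setT g.
  apply/(measurable_restrictT _ _).1; first exact: measurable_cube.
  exact: measurable_funTS.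
have g0 t : (0 <= g t)%E by rewrite /g patchE; case: ifP.
have mc : measurable_fun setT (@cons_pair R n) by exact: measurable_cons_pair.
have mgc : measurable_fun setT (g \o @cons_pair R n) by exact: measurableT_comp.
transitivity (\int[pushforward (mu \x l)%E (@cons_pair R n)]_t g t)%E.
  by rewrite integral_mkcond.
rewrite ge0_integral_pushforward// preimage_setT.
rewrite (fubini_tonelli1 (g \o @cons_pair R n)) /fubini_F; [|exact: mgc|]; last first.
  by move=> x; exact: g0.
pose h := ((f \o @cons_pair R n) \_ (setT `*` @cube R n))%E.
have mh : measurable_fun setT h.
  apply/(measurable_restrictT _ _).1.
    by apply: measurableX => //; exact: measurable_cube.
  by apply: measurable_funTS; exact: measurableT_comp.
have h0 w : (0 <= h w)%E by rewrite /h patchE; case: ifP => _; [exact: f0|].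
have hE x : (\int[lebesgue_tuple R n]_(t in @cube R n) f [tuple of x :: t] =
   \int[l]_t h (x, t))%E.
  rewrite integral_mkcond; apply: eq_integral => t _.
  rewrite /h !patchE; congr (if _ then _ else _).
  by apply/idP/idP; rewrite !inE /=; tauto.
under [RHS]eq_integral do rewrite hE.
rewrite unit_prob_integral; last 2 first.
- exact: (@measurable_fun_fubini_tonelli_F _ _ _ _ _ l h).
- by move=> x; exact: integral_ge0.
rewrite [RHS]integral_mkcond; apply: eq_integral => x _.
rewrite patchE; case: ifPn => xI; last first.
  apply: integral0_eq => t _; rewrite /g /= patchE memNset//= => ct.
  by move/negP: xI; apply; rewrite inE; have := ct ord0; rewrite /tnth.
apply: eq_integral => t _; rewrite /g /h /= !patchE; congr (if _ then _ else _).
rewrite inE in xI; apply/idP/idP; rewrite !inE /=.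
  by move=> ct; split => // i; have := ct (lift ord0 i); rewrite tnthS.
by move=> [_ ct] i; case: (unliftP ord0 i) => [j|] ->; rewrite ?tnthS.
Qed.

Lemma integral_cube n (f : n.-tuple mR -> R) : bmeas f -> (forall t, 0 <= f t) ->
  (\int[lebesgue_tuple R n]_(t in @cube R n) (f t)%:E = (iterJ U n f)%:E)%E.
Proof.
elim: n f => [|n IHn] f bf f0.
  rewrite /= integral_dirac; last 2 first.
  - exact: measurable_cube.
  - by apply/measurable_EFinP; apply: measurable_funTS; case: bf.
  by rewrite diracE mem_set ?mul1e//; case.
rewrite integral_cubeS; last 2 first.
- by apply/measurable_EFinP; case: bf.
- by move=> t; rewrite lee_fin.
rewrite /= -(bmeas_integralE U); last exact: bmeas_iterJ_cons.
by apply: eq_integral => x _; rewrite IHn//; exact: bmeas_cons.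
Qed.

Local Notation II := (I `*` I).

Lemma integral_square (f : mR * mR -> R) : bmeas f -> (forall z, 0 <= f z) ->
  (\int[mu \x mu]_(z in II) (f z)%:E = (J_ x, J_ y, f (x, y))%:E)%E.
Proof.
move=> bf f0; have mI := measurable_unit_itv.
pose F := ((EFin \o f) \_ II)%E.
have mF : measurable_fun setT F.
  apply/(measurable_restrictT _ _).1; first exact: measurableX.
  by apply: measurable_funTS; apply/measurable_EFinP; case: bf.
have F0 z : (0 <= F z)%E.
  by rewrite /F patchE; case: ifP => _; [rewrite /= lee_fin|].
rewrite integral_mkcond (fubini_tonelli1 F)// /fubini_F.
rewrite -(bmeas_integralE U); last exact: (bmeas_J U bf).
rewrite unit_prob_integral; last 2 first.
- by apply/measurable_EFinP; have [] := bmeas_J U bf.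
- by move=> x; rewrite lee_fin; apply: J_ge0.
rewrite [RHS]integral_mkcond; apply: eq_integral => x _.
have bfx : bmeas (fun y => f (x, y)) by solve_bmeas.
rewrite [RHS]patchE; case: ifPn => xI; last first.
  apply: integral0_eq => y _; rewrite /F /= patchE memNset//= => -[Ix _].
  by move/negP: xI; apply; rewrite inE.
rewrite inE in xI; rewrite -(bmeas_integralE U)// unit_prob_integral; last 2 first.
- by apply/measurable_EFinP; case: bfx.
- by move=> y; rewrite lee_fin.
rewrite [RHS]integral_mkcond; apply: eq_integral => y _.
rewrite /F !patchE; congr (if _ then _ else _).
by apply/idP/idP; rewrite !inE //= => -[].
Qed.

Lemma trunc_graphonE (W : mR * mR -> mR) x y : I x -> I y -> (W \_ II) (x, y) = W (x, y).
Proof. by move=> Ix Iy; rewrite patchE mem_set. Qed.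

Lemma trunc_graphon_out (W : mR * mR -> mR) z : ~ II z -> (W \_ II) z = 0.
Proof. by move=> nIz; rewrite patchE memNset. Qed.

(* A graphon is arbitrary outside the unit square; extending it by 0 makes it
   bounded and measurable everywhere. *)
Section trunc.
Variables (W : mR * mR -> mR) (gW : graphon W).
Let W0 := W \_ II.

Lemma trunc_graphon_itv z : 0 <= W0 z <= 1.
Proof.
have [_ _ W01] := gW; case: z => x y; have [[Ix Iy]|nI] := pselect (II (x, y)).
  by rewrite /W0 trunc_graphonE//; exact: W01.
by rewrite /W0 trunc_graphon_out// lexx ler01.
Qed.

Lemma trunc_graphon_sym x y : W0 (x, y) = W0 (y, x).
Proof.
have [_ Ws _] := gW; have [[Ix Iy]|nI] := pselect (II (x, y)).
  by rewrite /W0 !trunc_graphonE//; exact: Ws.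
by rewrite /W0 !trunc_graphon_out// => -[Iy Ix]; exact: nI.
Qed.

Lemma bmeas_trunc_graphon : bmeas W0.
Proof.
split; last first.
  by exists 1 => z; have /andP[W00 W01] := trunc_graphon_itv z; rewrite ger0_norm.
have [mW _ _] := gW.
apply/(measurable_restrictT _ _).1 => //.
by apply: measurableX; exact: measurable_unit_itv.
Qed.

Lemma hom_densityE n (e : rel 'I_n) : hom_density e W =
  (iterJ U n (fun t => \prod_(uv : 'I_n * 'I_n | (uv.1 < uv.2)%N && e uv.1 uv.2)
     W0 (tnth t uv.1, tnth t uv.2)))%:E.
Proof.
rewrite -integral_cube; last 2 first.
- by apply: bmeas_prod => uv; apply: bmeas_tnth2; exact: bmeas_trunc_graphon.
- by move=> t; apply: prodr_ge0 => uv _; have /andP[] := trunc_graphon_itv (tnth t uv.1, tnth t uv.2).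
apply: eq_integral => t; rewrite inE => ct; congr (_%:E).
by apply: eq_bigr => uv _; rewrite /W0 trunc_graphonE.
Qed.

Lemma tind_clawE : tind_claw W =
  (J_ c, J_ x, J_ y, J_ z, W0 (c, x) * W0 (c, y) * W0 (c, z) *
    ((1 - W0 (x, y)) * (1 - W0 (y, z)) * (1 - W0 (x, z))))%:E.
Proof.
pose f (V : mR * mR -> R) (t : 4.-tuple mR) : R :=
  (\prod_(i < 4 | (0 < i)%N) V (tnth t ord0, tnth t i)) *
     (\prod_(i < 4 | (0 < i)%N) \prod_(j < 4 | (i < j)%N)
        (1 - V (tnth t i, tnth t j))).
have bW := bmeas_trunc_graphon; have W01 := trunc_graphon_itv.
have bf : bmeas (f W0).
  apply: bmeasM.
    by apply: bmeas_prod => i; exact: bmeas_tnth2.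
  apply: bmeas_prod => i; apply: bmeas_prod => j.
  by apply: bmeasD; [exact: bmeas_cst|apply: bmeasN; exact: bmeas_tnth2].
transitivity (\int[lebesgue_tuple R 4]_(t in @cube R 4) (f W0 t)%:E)%E.
  apply: eq_integral => t; rewrite inE => ct; congr (_%:E); rewrite /f; congr (_ * _).
    by apply: eq_bigr => i _; rewrite /W0 trunc_graphonE.
  by do 2! (apply: eq_bigr => ? _); rewrite /W0 trunc_graphonE.
have f0 t : 0 <= f W0 t.
  apply: mulr_ge0; apply: prodr_ge0 => i _.
    by have /andP[] := W01 (tnth t ord0, tnth t i).
  apply: prodr_ge0 => j _; rewrite subr_ge0.
  by have /andP[] := W01 (tnth t i, tnth t j).
rewrite (integral_cube bf f0).
have fE c x y z : f W0 [tuple of c :: [tuple of x :: [tuple of y :: [tuple of z :: [tuple]]]]] =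
    W0 (c, x) * W0 (c, y) * W0 (c, z) *
    ((1 - W0 (x, y)) * (1 - W0 (y, z)) * (1 - W0 (x, z))).
  rewrite /f; move: W0 => V.
  (* Keeping the filter as a conditional lets the index conditions compute, which leaves a
     polynomial identity. *)
  have prod4E (p : pred 'I_4) (F : 'I_4 -> R) : \prod_(i < 4 | p i) F i =
      (if p ord0 then F ord0 else 1) * ((if p (lift ord0 ord0) then F (lift ord0 ord0) else 1) *
      ((if p (lift ord0 (lift ord0 ord0)) then F (lift ord0 (lift ord0 ord0)) else 1) *
      (if p (lift ord0 (lift ord0 (lift ord0 ord0))) then
       F (lift ord0 (lift ord0 (lift ord0 ord0))) else 1))).
    by rewrite big_mkcond !big_ord_recl big_ord0 /= mulr1.
  rewrite !prod4E /= !(tnth_nth 0) /=.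
  rewrite !mul1r !mulr1; ring.
apply: (congr1 EFin).
transitivity (J_ c, J_ x, J_ y, J_ z, f W0
    [tuple of c :: [tuple of x :: [tuple of y :: [tuple of z :: [tuple]]]]]).
  by [].
apply: eqJ => c; apply: eqJ => x; apply: eqJ => y; apply: eqJ => z; exact: fE.
Qed.

End trunc.

End unit_interval.

(** * The function I_p *)

Section relative_entropy.
Context (R : realType).
Implicit Types p x : R.

Lemma ln2_gt0 : 0 < ln 2 :> R.
Proof. by apply: ln_gt0; rewrite ltr1n. Qed.

Lemma log2_lt0 x : 0 < x < 1 -> log2 x < 0.
Proof. by move=> /ln_lt0 h; rewrite /log2 pmulr_llt0// invr_gt0 ln2_gt0. Qed.

Lemma log2_1 : log2 1 = 0 :> R.
Proof. by rewrite /log2 ln1 mul0r. Qed.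

Lemma I_0 p : I_ p 0 = log2 (1 - p).
Proof. by rewrite /I_ mul0r add0r subr0 mul1r divr1. Qed.

Lemma I_1 p : I_ p 1 = log2 p.
Proof. by rewrite /I_ subrr mul0r addr0 mul1r divr1. Qed.

Lemma I_p p : 0 < p < 1 -> I_ p p = 0.
Proof.
move=> /andP[p0 p1]; rewrite /I_ !divff ?log2_1 ?mulr0 ?addr0//.
  by rewrite subr_eq0 eq_sym lt_eqF.
by rewrite gt_eqF.
Qed.

(** Gibbs' inequality: [ln y <= y - 1], strictly unless [y = 1], at [p / x] and [(1 - p) / (1 - x)];
    the two upper bounds add up to 0. *)
Lemma I_lt0 p x : 0 < p < 1 -> 0 < x < 1 -> x != p -> I_ p x < 0.
Proof.
move=> /andP[p0 p1] /andP[x0 x1] xp.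
have q0 : 0 < 1 - p by rewrite subr_gt0.
have y0 : 0 < 1 - x by rewrite subr_gt0.
have ln_lt (y : R) : 0 < y -> y != 1 -> ln y < y - 1.
  move=> y_gt0 y1; rewrite ltrBrDl -[ltRHS](lnK y_gt0); apply: expR_gt1Dx.
  by rewrite ln_eq0.
have ln_le (y : R) : 0 < y -> ln y <= y - 1.
  move=> y_gt0; have [->|y1] := eqVneq y 1; first by rewrite ln1 subrr.
  exact/ltW/ln_lt.
have h1 : x * ln (p / x) < p - x.
  have : ln (p / x) < p / x - 1.
    apply: ln_lt; first exact: divr_gt0.
    by apply: contraNneq xp => h; rewrite -[p](divfK (lt0r_neq0 x0)) h mul1r.
  by rewrite -(ltr_pM2l x0) mulrBr mulr1 mulrCA divff ?gt_eqF// mulr1.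
have h2 : (1 - x) * ln ((1 - p) / (1 - x)) <= (1 - p) - (1 - x).
  have := ln_le _ (divr_gt0 q0 y0).
  by rewrite -(ler_pM2l y0) mulrBr mulr1 mulrCA divff ?gt_eqF// mulr1.
have -> : I_ p x = (x * ln (p / x) + (1 - x) * ln ((1 - p) / (1 - x))) / ln 2.
  by rewrite /I_ /log2 !mulrA -mulrDl.
rewrite pmulr_llt0 ?invr_gt0 ?ln2_gt0//.
rewrite (lt_le_trans (ltr_leD h1 h2))//.
by rewrite (_ : _ + _ = 0)//; ring.
Qed.

(** Where the logarithm of a quotient does not split, at [x = 0] in the first term and [x = 1] in
    the second, the factor in front is 0. *)
Lemma I_lnE p x : 0 < p < 1 -> 0 <= x <= 1 ->
  I_ p x = (x * (ln p - ln x) + (1 - x) * (ln (1 - p) - ln (1 - x))) / ln 2.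
Proof.
move=> /andP[p0 p1] /andP[x0 x1].
have q0 : 0 < 1 - p by rewrite subr_gt0.
rewrite /I_ /log2 !mulrA -mulrDl; congr (_ / _); congr (_ + _).
  move: x0; rewrite le_eqVlt => /predU1P[<-|x0]; first by rewrite !mul0r.
  by rewrite ln_div.
move: x1; rewrite le_eqVlt => /predU1P[->|x1]; first by rewrite subrr !mul0r.
by rewrite ln_div// posrE subr_gt0.
Qed.

(** Makes [I_ p] of a graphon bounded. For [0 < t < 1], [y * (ln t - ln y) >= y * ln t >= ln t], as
    [y * ln y <= 0]. *)
Lemma I_ge p x : 0 < p < 1 -> 0 <= x <= 1 -> log2 p + log2 (1 - p) <= I_ p x.
Proof.
move=> p01 x01; have /andP[p0 p1] := p01; have /andP[x0 x1] := x01.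
have q01 : 0 < 1 - p < 1 by rewrite subr_gt0 p1 gtrBl.
rewrite I_lnE// /log2 -mulrDl ler_wpM2r ?invr_ge0 ?(ltW ln2_gt0)//.
have aux (t y : R) : 0 < t < 1 -> 0 <= y <= 1 -> ln t <= y * (ln t - ln y).
  move=> t01 /andP[y0 y1]; have lt0 := ln_lt0 t01.
  have h : y * ln y <= 0 by rewrite mulr_ge0_le0// ln_le0.
  rewrite mulrBr (@le_trans _ _ (y * ln t))//; last by rewrite lerBrDr gerDl.
  rewrite -subr_le0 (_ : _ - _ = (1 - y) * ln t); last by ring.
  by rewrite mulr_ge0_le0 ?subr_ge0// ltW.
by rewrite lerD// aux// subr_ge0 x1 gerBl.
Qed.

(** Equality for white and black; grey values fall under Gibbs' inequality. Casting the comparisons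
    to numbers makes the bound integrate linearly. *)
Lemma I_le_colour p x : 0 < p < 1 -> 0 <= x <= 1 ->
  I_ p x <= log2 (1 - p) * (x <= 0)%R%:R + log2 p * (1 <= x)%R%:R.
Proof.
move=> p01 /andP[x0 x1].
case: (leP x 0) => [xle0|xgt0].
  have -> : x = 0 by apply/eqP; rewrite eq_le xle0.
  by rewrite I_0 ler10 /= mulr1 mulr0 addr0.
case: (leP 1 x) => [xge1|xlt1].
  have -> : x = 1 by apply/eqP; rewrite eq_le x1.
  by rewrite I_1 mulr0 add0r mulr1.
rewrite !mulr0 addr0; have [->|xp] := eqVneq x p; first by rewrite I_p.
by apply/ltW/I_lt0 => //; rewrite xgt0.
Qed.

Lemma I_le0 p x : 0 < p < 1 -> 0 <= x <= 1 -> I_ p x <= 0.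
Proof.
move=> p01 x01; apply: (le_trans (I_le_colour p01 x01)).
have /andP[p0 p1] := p01.
have q01 : 0 < 1 - p < 1 by rewrite subr_gt0 p1 gtrBl.
by rewrite -[leRHS]addr0 lerD// mulr_le0_ge0 ?ler0n// ltW// log2_lt0.
Qed.

Lemma bmeas_I_ d (T : measurableType d) p (W : T -> R) : 0 < p < 1 ->
  bmeas W -> (forall z, 0 <= W z <= 1) -> bmeas (fun z => I_ p (W z)).
Proof.
move=> p01 [mW _] W01; split; last first.
  exists (- (log2 p + log2 (1 - p))) => z.
  by rewrite ler0_norm ?I_le0// lerN2 I_ge.
rewrite (_ : (fun _ => _) = fun z => (W z * (ln p - ln (W z)) +
   (1 - W z) * (ln (1 - p) - ln (1 - W z))) / ln 2); last first.
  by apply/funext => z; rewrite I_lnE.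
have mW1 : measurable_fun setT (fun z => 1 - W z).
  by apply: measurable_funB.
apply: measurable_funM => //; apply: measurable_funD; apply: measurable_funM => //.
  apply: measurable_funB => //.
  exact: (measurableT_comp (@measurable_ln R) mW).
apply: measurable_funB => //.
exact: (measurableT_comp (@measurable_ln R) mW1).
Qed.

(** [p_crit] is the smaller root of [(1 - p) ^+ 2 - p]; the other root [(3 + s) / 2] exceeds 1, so
    its factor is positive. *)
Lemma p_critE p : p < 1 -> (p < p_crit R) = (p < (1 - p) ^+ 2).
Proof.
move=> p1; set s := Num.sqrt 5 : R.
have s2 : s * s = 5 by rewrite -expr2 sqr_sqrtr// ler0n.
have s0 : 0 <= s by exact: sqrtr_ge0.
have s1 : 1 < s.
  rewrite ltNge; apply/negP => s_le1.
  have : s * s <= 1 * 1 by apply: ler_pM.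
  by rewrite s2 mulr1 leNgt ltr1n.
have q0 : 0 < (3 + s) / 2 - p by lra.
have E : (1 - p) ^+ 2 - p = ((3 - s) / 2 - p) * ((3 + s) / 2 - p).
  apply/eqP; rewrite -subr_eq0; apply/eqP.
  transitivity ((s * s - 5) / 4); last by rewrite s2 subrr mul0r.
  by field.
by rewrite /p_crit -/s -subr_gt0 -[RHS]subr_gt0 E pmulr_lgt0.
Qed.

Lemma p_crit_itv : 0 < p_crit R < 1.
Proof.
set s := Num.sqrt 5 : R.
have s2 : s * s = 5 by rewrite -expr2 sqr_sqrtr// ler0n.
have s0 : 0 <= s by exact: sqrtr_ge0.
rewrite /p_crit -/s; apply/andP; split; nra.
Qed.

Lemma p_crit_root : (1 - p_crit R) ^+ 2 = p_crit R.
Proof.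
set s := Num.sqrt 5 : R.
have s2 : s * s = 5 by rewrite -expr2 sqr_sqrtr// ler0n.
rewrite /p_crit -/s; apply/eqP; rewrite -subr_eq0; apply/eqP.
transitivity ((s * s - 5) / 4); last by rewrite s2 subrr mul0r.
by field.
Qed.

Lemma log2_sqr x : 0 < x -> log2 (x ^+ 2) = 2 * log2 x.
Proof. by move=> x0; rewrite /log2 lnXn// -[_ *+ 2]mulr_natl mulrA. Qed.

Lemma ltr_log2 x y : 0 < x -> 0 < y -> (log2 x < log2 y) = (x < y).
Proof.
by move=> x0 y0; rewrite /log2 ltr_pM2r ?invr_gt0 ?ln2_gt0// ltr_ln.
Qed.

Lemma lt_p_crit_log p : 0 < p < 1 -> (p < p_crit R) = (log2 p < 2 * log2 (1 - p)).
Proof.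
move=> /andP[p0 p1]; have q0 : 0 < 1 - p by rewrite subr_gt0.
by rewrite p_critE// -log2_sqr// ltr_log2// exprn_gt0.
Qed.

Lemma p_crit_log : log2 (p_crit R) = 2 * log2 (1 - p_crit R).
Proof.
have /andP[p0 p1] := p_crit_itv.
by rewrite -{1}p_crit_root log2_sqr// subr_gt0.
Qed.

Lemma gt_p_crit_log p : 0 < p < 1 -> p_crit R < p -> 2 * log2 (1 - p) < log2 p.
Proof.
move=> p01 pcp; rewrite lt_neqAle leNgt -lt_p_crit_log// -leNgt (ltW pcp) andbT.
have /andP[p0 p1] := p01; have q0 : 0 < 1 - p by rewrite subr_gt0.
rewrite -log2_sqr//; apply/eqP.
have aux (x y : R) : 0 < x -> 0 < y -> log2 x = log2 y -> x = y.
  move=> x0 y0 e; apply/eqP; rewrite eq_le !leNgt.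
  by rewrite -(ltr_log2 y0 x0) -(ltr_log2 x0 y0) e ltxx.
move=> /(aux _ _ (exprn_gt0 2 q0) p0) e.
have /andP[c0 c1] := p_crit_itv; have er := p_crit_root.
(* Otherwise [p] and [p_crit] are distinct roots below 1 of a quadratic whose roots add up to 3. *)
have : (p - p_crit R) * (p + p_crit R - 3) = 0.
  have -> : (p - p_crit R) * (p + p_crit R - 3) = 
     ((1 - p) ^+ 2 - p) - ((1 - p_crit R) ^+ 2 - p_crit R) by ring.
  by rewrite e er !subrr.
move/eqP; rewrite mulf_eq0 => /orP[] /eqP h; lra.
Qed.

End relative_entropy.

(** * Entropy of claw-free graphons *)

Section claw_free_graphons.
Context (R : realType).
Local Notation mR := (measurableTypeR R).
Local Notation I := (@unit_itv R).
Local Notation II := (I `*` I).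
Local Notation U := (unit_prob R).

Local Notation "'J_' x , f" := (Rintegral U setT (fun x => f))
  (at level 200, x name, f at level 200, only parsing).
Local Notation J := (Rintegral U setT).

Lemma JN (f : mR -> R) : bmeas f -> (J_ x, - f x) = - J f.
Proof.
by move=> bf; rewrite -mulN1r -JZ//; apply: eqJ => x; rewrite mulN1r.
Qed.

Lemma J_on0 (h f : mR -> R) : bmeas h -> (forall x, 0 <= h x) -> J h = 0 ->
  bmeas f -> (forall x, h x = 0 -> f x = 0) -> J f = 0.
Proof.
move=> bh h0 Jh bf hf; rewrite -(Jcst U 0).
by apply: (eq_J_on0 bh h0 Jh) => //; exact: bmeas_cst.
Qed.

Lemma JJ_on0 (h f : mR * mR -> R) : bmeas h -> (forall z, 0 <= h z) ->
  (J_ x, J_ y, h (x, y)) = 0 -> bmeas f -> (forall z, h z = 0 -> f z = 0) ->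
  (J_ x, J_ y, f (x, y)) = 0.
Proof.
move=> bh h0 Jh bf hf; apply: (J_on0 _ _ Jh); [solve_bmeas| |solve_bmeas|].
  by move=> x; apply: J_ge0.
move=> x hx; apply: (J_on0 _ _ hx); [solve_bmeas|by []|solve_bmeas|].
by move=> y; exact: hf.
Qed.

Lemma JJ_D (f g : mR * mR -> R) : bmeas f -> bmeas g ->
  (J_ x, J_ y, f (x, y) + g (x, y)) = (J_ x, J_ y, f (x, y)) + (J_ x, J_ y, g (x, y)).
Proof.
move=> bf bg; rewrite -JD; [|solve_bmeas|solve_bmeas].
by apply: eqJ => x; rewrite -JD; [|solve_bmeas|solve_bmeas].
Qed.

Lemma JJ_Z (k : R) (f : mR * mR -> R) : bmeas f ->
  (J_ x, J_ y, k * f (x, y)) = k * (J_ x, J_ y, f (x, y)).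
Proof.
move=> bf; rewrite -JZ; last by solve_bmeas.
by apply: eqJ => x; rewrite -JZ; [|solve_bmeas].
Qed.

Lemma JJ_1B (f : mR * mR -> R) : bmeas f ->
  (J_ x, J_ y, 1 - f (x, y)) = 1 - (J_ x, J_ y, f (x, y)).
Proof.
move=> bf; transitivity (J_ x, 1 - J_ y, f (x, y)).
  by apply: eqJ => x; rewrite JB ?Jcst//; solve_bmeas.
by rewrite JB ?Jcst//; solve_bmeas.
Qed.

Lemma le_JJ (f g : mR * mR -> R) : bmeas f -> bmeas g -> (forall z, f z <= g z) ->
  (J_ x, J_ y, f (x, y)) <= (J_ x, J_ y, g (x, y)).
Proof.
move=> bf bg fg; apply: le_J; [solve_bmeas|solve_bmeas|] => x.
by apply: le_J; [solve_bmeas|solve_bmeas|] => y.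
Qed.

Lemma mean_kernel_itv (K : mR * mR -> R) : bmeas K -> (forall z, 0 <= K z <= 1) ->
  0 <= (J_ x, J_ y, K (x, y)) <= 1.
Proof.
move=> bK K01; apply/andP; split.
  by apply: J_ge0 => x; apply: J_ge0 => y; have /andP[] := K01 (x, y).
rewrite -[leRHS](Jcst U) -[X in _ <= J_ _, X](Jcst U).
by apply: (le_JJ bK (bmeas_cst _ 1)) => z; have /andP[] := K01 z.
Qed.

(** This and the next kernel are [E] and [F] of the overview; strict comparisons detect the colours
    because graphon values lie in [[0, 1]]. *)
Definition nonzero_kernel (W : mR * mR -> R) z : R := (0 < W z)%R%:R.

Definition nonone_kernel (W : mR * mR -> R) z : R := (W z < 1)%R%:R.

Lemma bmeas_nonzero_kernel W : bmeas W -> bmeas (nonzero_kernel W).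
Proof.
move=> [mW _]; rewrite (_ : nonzero_kernel W = \1_(W @^-1` `]0, +oo[%classic)).
  apply: bmeas_indic; rewrite -[X in measurable X]setTI.
  by apply: mW => //; exact: measurable_itv.
apply/funext => z; rewrite /nonzero_kernel indicE; congr (nat_of_bool _)%:R.
by apply/idP/idP; rewrite inE /= in_itv /= andbT.
Qed.

Lemma bmeas_nonone_kernel W : bmeas W -> bmeas (nonone_kernel W).
Proof.
move=> [mW _]; rewrite (_ : nonone_kernel W = \1_(W @^-1` `]-oo, 1[%classic)).
  apply: bmeas_indic; rewrite -[X in measurable X]setTI.
  by apply: mW => //; exact: measurable_itv.
apply/funext => z; rewrite /nonone_kernel indicE; congr (nat_of_bool _)%:R.
by apply/idP/idP; rewrite inE /= in_itv /=.
Qed.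

Lemma natr_bool_itv (b : bool) : 0 <= (b%:R : R) <= 1.
Proof. by case: b; rewrite /= ?lexx ?ler01. Qed.

Section colours.
Variables (W : mR * mR -> mR) (cW : claw_free_graphon W).
Let gW : graphon W. Proof. by case: cW. Qed.
Let W0 : mR * mR -> R := W \_ II.
Let E := nonzero_kernel W0.
Let F := nonone_kernel W0.
Let bW : bmeas W0. Proof. exact: bmeas_trunc_graphon. Qed.
Let bE : bmeas E. Proof. exact: bmeas_nonzero_kernel. Qed.
Let bF : bmeas F. Proof. exact: bmeas_nonone_kernel. Qed.
Let E01 z : 0 <= E z <= 1. Proof. exact: natr_bool_itv. Qed.
Let F01 z : 0 <= F z <= 1. Proof. exact: natr_bool_itv. Qed.
Let W01 z : 0 <= W0 z <= 1. Proof. exact: trunc_graphon_itv. Qed.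

(** A factor [E] or [F] is nonzero only where the factor [W0] or [1 - W0] it replaces is nonzero.
    The null sets are removed one variable at a time. *)
Lemma claw_colours :
  (J_ c, J_ x, J_ y, J_ z, E (c, x) * E (c, y) * E (c, z) *
    (F (x, y) * F (y, z) * F (x, z))) = 0.
Proof.
have [_ /eqP] := cW; rewrite (tind_clawE gW) -/W0 => /eqP [].
pose B z := 1 - W0 z.
have bB : bmeas B by rewrite /B; solve_bmeas.
have B0 z : 0 <= B z by rewrite subr_ge0; have /andP[] := W01 z.
have W00 z : 0 <= W0 z by have /andP[] := W01 z.
have nW z : E z != 0 -> W0 z != 0.
  by rewrite /E /nonzero_kernel; case: ltgtP; rewrite ?eqxx.
have nB z : F z != 0 -> B z != 0.
  by rewrite /F /nonone_kernel /B subr_eq0 eq_sym; case: ltgtP; rewrite ?eqxx.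
move=> claw0.
have {}claw0 : (J_ c, J_ x, J_ y, J_ z, W0 (c, x) * W0 (c, y) * W0 (c, z) *
    (B (x, y) * B (y, z) * B (x, z))) = 0 by exact: claw0.
have ge0 c x y z : 0 <= W0 (c, x) * W0 (c, y) * W0 (c, z) *
    (B (x, y) * B (y, z) * B (x, z)) by rewrite !mulr_ge0.
apply: (J_on0 _ _ claw0); [solve_bmeas| |solve_bmeas|].
  by move=> c; do 3! (apply: J_ge0 => ?); exact: ge0.
move=> c hc; apply: (J_on0 _ _ hc); [solve_bmeas| |solve_bmeas|].
  by move=> x; do 2! (apply: J_ge0 => ?); exact: ge0.
move=> x hx; apply: (J_on0 _ _ hx); [solve_bmeas| |solve_bmeas|].
  by move=> y; apply: J_ge0 => ?; exact: ge0.
move=> y hy; apply: (J_on0 _ _ hy); [solve_bmeas| |solve_bmeas|].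
  by move=> z; exact: ge0.
move=> z /eqP h; apply/eqP; apply: contraTT h.
rewrite !mulf_eq0 !negb_or => /andP[/andP[/andP[? ?] ?] /andP[/andP[? ?] ?]].
by rewrite !nW// !nB.
Qed.

(* [E] has mean black + grey, and [1 - F] has mean black. *)
Lemma black_ge_grey : (J_ x, J_ y, E (x, y)) <= 2 * (1 - J_ x, J_ y, F (x, y)).
Proof.
apply: claw_free_kernel_le => //; last exact: claw_colours.
- by move=> x y; rewrite /E /nonzero_kernel /W0 (trunc_graphon_sym gW).
- by move=> x y; rewrite /F /nonone_kernel /W0 (trunc_graphon_sym gW).
Qed.

Section entropy.
Variables (p : R) (p01 : 0 < p < 1).
Let L1 := log2 (1 - p).
Let Lp := log2 p.
Let bI : bmeas (fun z => I_ p (W0 z)). Proof. exact: bmeas_I_. Qed.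

(** [integral_square] treats nonnegative functions and [I_ p] is at most 0, so the sign is changed
    before and after. *)
Lemma I_integralE : I_integral p W = (J_ x, J_ y, I_ p (W0 (x, y)))%:E.
Proof.
transitivity (\int[@lebesgue_measure R \x @lebesgue_measure R]_(z in II)
    (- (- I_ p (W0 z))%:E))%E.
  apply: eq_integral => -[x y]; rewrite inE => -[Ix Iy].
  by rewrite -EFinN opprK /W0 trunc_graphonE.
have bI' : bmeas (fun z => - I_ p (W0 z)) by exact: bmeasN.
rewrite integral_ge0N; last by move=> z _; rewrite lee_fin oppr_ge0 I_le0.
rewrite (integral_square bI'); last by move=> z; rewrite oppr_ge0 I_le0.
rewrite -EFinN; congr (_%:E); rewrite -JN; last first.
  by exact: (bmeas_J U bI').
apply: eqJ => x; rewrite JN ?opprK//.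
exact: (bmeas_comp bI (measurable_pair1 x)).
Qed.

Let col z := L1 * (1 - E z) + Lp * (1 - F z).
Let bcol : bmeas col. Proof. by rewrite /col; solve_bmeas. Qed.

Lemma I_le_col z : I_ p (W0 z) <= col z.
Proof.
rewrite /col /E /F /nonzero_kernel /nonone_kernel.
rewrite (le_trans (I_le_colour p01 (W01 z)))//.
by case: (leP (W0 z) 0) => _; case: (leP 1 (W0 z)) => _; rewrite ?subrr ?subr0.
Qed.

(** On a grey pair [col] is 0, a value that [I_ p] takes strictly between 0 and 1 only at [p]. *)
Lemma I_eq_col z : I_ p (W0 z) = col z -> E z = 1 -> F z = 1 -> W0 z = p.
Proof.
rewrite /col /E /F /nonzero_kernel /nonone_kernel => h e f.
move: h; rewrite e f subrr !mulr0 addr0 => h.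
have W_0 : 0 < W0 z by move: e; case: (0 < W0 z) => // /eqP; rewrite eq_sym oner_eq0.
have W_1 : W0 z < 1 by move: f; case: (W0 z < 1) => // /eqP; rewrite eq_sym oner_eq0.
apply/eqP; apply: contraT => /(@I_lt0 _ _ _ p01).
by rewrite h ltxx W_0 W_1 => /(_ isT).
Qed.

Lemma JJ_col : (J_ x, J_ y, col (x, y)) =
  L1 * (1 - J_ x, J_ y, E (x, y)) + Lp * (1 - J_ x, J_ y, F (x, y)).
Proof.
have b1 : bmeas (fun z => 1 - E z) by solve_bmeas.
have b2 : bmeas (fun z => 1 - F z) by solve_bmeas.
rewrite -(JJ_1B bE) -(JJ_1B bF) -(JJ_Z L1 b1) -(JJ_Z Lp b2).
by rewrite -(JJ_D (bmeasM (bmeas_cst _ L1) b1) (bmeasM (bmeas_cst _ Lp) b2)).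
Qed.

Lemma entropy_le : (J_ x, J_ y, I_ p (W0 (x, y))) <=
  L1 * (1 - J_ x, J_ y, E (x, y)) + Lp * (1 - J_ x, J_ y, F (x, y)).
Proof. by rewrite -JJ_col; apply: (le_JJ bI bcol); exact: I_le_col. Qed.

End entropy.
End colours.

End claw_free_graphons.

(** * Maximizers *)

Section colour_densities.
Context (R : realType).
Implicit Types a b w k : R.

(** Here [a] and [b] stand for [log2 (1 - p)] and [log2 p], [w] and [k] for the white and black
    densities, and [1 - w <= 2 * k] says that grey is at most black. It is a linear program with
    certificates [h1] and [h2]; below [p_crit] all white is optimal. *)
Lemma colour_bound_small a b w k : a < 0 -> b < 2 * a -> 0 <= k -> 1 - w <= 2 * k ->
  a * w + b * k <= a.
Proof.
move=> a0 ba k0 wk.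
have h1 : 0 <= (2 * k - (1 - w)) * - a.
  by rewrite mulr_ge0// ?subr_ge0// oppr_ge0 ltW.
have h2 : 0 <= k * (2 * a - b) by rewrite mulr_ge0// subr_ge0 ltW.
lra.
Qed.

Lemma colour_eq_small a b w k : a < 0 -> b < 2 * a -> 0 <= k -> 1 - w <= 2 * k ->
  a <= a * w + b * k -> k = 0.
Proof.
move=> a0 ba k0 wk h.
have h1 : 0 <= (2 * k - (1 - w)) * - a.
  by rewrite mulr_ge0// ?subr_ge0// oppr_ge0 ltW.
apply/eqP; rewrite eq_le k0 andbT -(@pmulr_lle0 _ (2 * a - b)) ?subr_gt0//.
lra.
Qed.

Lemma colour_bound_large a b w k : b < 0 -> 2 * a <= b -> 0 <= w -> 1 - w <= 2 * k ->
  a * w + b * k <= 1 / 2 * b.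
Proof.
move=> b0 ab w0 wk.
have h1 : 0 <= (2 * k - (1 - w)) * - b.
  by rewrite mulr_ge0// ?subr_ge0// oppr_ge0 ltW.
have h2 : 0 <= w * (b - 2 * a) by rewrite mulr_ge0// subr_ge0.
lra.
Qed.

(** White mass would cost a positive multiple of [b - 2 * a]; once it is 0, the constraint and the
    assumed value squeeze [k] to 1/2. *)
Lemma colour_eq_large a b w k : b < 0 -> 2 * a < b -> 0 <= w -> 1 - w <= 2 * k ->
  1 / 2 * b <= a * w + b * k -> w = 0 /\ k = 1 / 2.
Proof.
move=> b0 ab w0 wk h.
have h1 : 0 <= (2 * k - (1 - w)) * - b.
  by rewrite mulr_ge0// ?subr_ge0// oppr_ge0 ltW.
have w_eq0 : w = 0.
  apply/eqP; rewrite eq_le w0 andbT -(@pmulr_lle0 _ (b - 2 * a)) ?subr_gt0//.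
  lra.
split=> //; rewrite w_eq0 in wk h h1; apply/eqP; rewrite eq_le.
apply/andP; split; last by lra.
have : (2 * k - 1) * - b <= 0 by lra.
by rewrite pmulr_lle0 ?oppr_gt0//; lra.
Qed.

End colour_densities.

Section maximizers.
Context (R : realType).
Local Notation mR := (measurableTypeR R).
Local Notation I := (@unit_itv R).
Local Notation II := (I `*` I).
Local Notation U := (unit_prob R).

Local Notation "'J_' x , f" := (Rintegral U setT (fun x => f))
  (at level 200, x name, f at level 200, only parsing).
Local Notation J := (Rintegral U setT).

(** Value [k0] inside [A] and inside its complement, [k0 + k1] across. Parameters [0, 0] give the
    empty graphon, and [1, p - 1] two cliques joined by density [p]. *)
Definition step_kernel (k0 k1 : R) (A : set mR) (z : mR * mR) : R :=
  k0 + k1 * cut_kernel A z.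

Lemma bmeas_step_kernel k0 k1 A : measurable A -> bmeas (step_kernel k0 k1 A).
Proof.
move=> mA; have bA : bmeas (\1_A : mR -> R) by exact: bmeas_indic.
by rewrite /step_kernel /cut_kernel; solve_bmeas.
Qed.

(** The density integrand of a step kernel as a function of the indicator values alone, the form to
    which [iterJ_indic_law] applies. *)
Definition step_weight k0 k1 n (e : rel 'I_n) (s : n.-tuple R) : R :=
  \prod_(uv : 'I_n * 'I_n | (uv.1 < uv.2)%N && e uv.1 uv.2)
    (k0 + k1 * (tnth s uv.1 + tnth s uv.2 - 2 * (tnth s uv.1 * tnth s uv.2))).

Lemma hom_density_step (W : mR * mR -> mR) k0 k1 A n (e : rel 'I_n) :
  graphon W -> measurable A ->
  (J_ x, J_ y, ((W \_ II) (x, y) - step_kernel k0 k1 A (x, y)) ^+ 2) = 0 ->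
  hom_density e W = (iterJ U n (fun t => step_weight k0 k1 e (map_tuple \1_A t)))%:E.
Proof.
move=> gW mA JW; rewrite hom_densityE//; congr (_%:E).
set W0 : mR * mR -> R := W \_ II in JW *.
have bW : bmeas W0 by exact: bmeas_trunc_graphon.
have bS := bmeas_step_kernel k0 k1 mA.
pose D z := (W0 z - step_kernel k0 k1 A z) ^+ 2.
have bD : bmeas D by rewrite /D; solve_bmeas.
have D0 z : 0 <= D z by exact: sqr_ge0.
pose P (uv : 'I_n * 'I_n) := (uv.1 < uv.2)%N && e uv.1 uv.2.
(* [h] adds the squared errors over the edges. Each has mean zero, and where [h] vanishes the two
   products agree factor by factor. *)
pose h (t : n.-tuple mR) := \sum_(uv | P uv) D (tnth t uv.1, tnth t uv.2).
transitivity (iterJ U n (fun t => \prod_(uv | P uv)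
    step_kernel k0 k1 A (tnth t uv.1, tnth t uv.2))); last first.
  apply: eq_iterJ => t; apply: eq_bigr => uv _.
  by rewrite !tnth_map.
apply: (@eq_iterJ_on0 _ _ _ U n h).
- by apply: bmeas_sum => uv; exact: bmeas_tnth2.
- by move=> t; apply: sumr_ge0 => uv _; exact: D0.
- rewrite /h iterJ_sum; last by move=> uv; exact: bmeas_tnth2.
  by apply: big1 => uv /andP[uv12 _]; rewrite iterJ_tnth2.
- by apply: bmeas_prod => uv; exact: bmeas_tnth2.
- by apply: bmeas_prod => uv; exact: bmeas_tnth2.
move=> t /eqP; rewrite psumr_eq0; last by move=> uv _; exact: D0.
move=> /allP ht; apply: eq_bigr => uv Puv.
have /implyP/(_ Puv) := ht uv (mem_index_enum _).
by rewrite /D sqrf_eq0 subr_eq0 => /eqP.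
Qed.

Lemma step_graphon_equiv (W1 W2 : mR * mR -> mR) k0 k1 A1 A2 :
  graphon W1 -> graphon W2 -> measurable A1 -> measurable A2 -> J \1_A1 = J \1_A2 ->
  (J_ x, J_ y, ((W1 \_ II) (x, y) - step_kernel k0 k1 A1 (x, y)) ^+ 2) = 0 ->
  (J_ x, J_ y, ((W2 \_ II) (x, y) - step_kernel k0 k1 A2 (x, y)) ^+ 2) = 0 ->
  graphon_equiv W1 W2.
Proof.
move=> gW1 gW2 mA1 mA2 A12 h1 h2 n e _ _.
rewrite (hom_density_step e gW1 mA1 h1) (hom_density_step e gW2 mA2 h2).
by rewrite (iterJ_indic_law (step_weight k0 k1 e) mA1 mA2 A12).
Qed.

Section fixed_p.
Variables (p : R) (p01 : 0 < p < 1).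

Let L1_lt0 : log2 (1 - p) < 0.
Proof. by apply: log2_lt0; have /andP[? ?] := p01; rewrite subr_gt0 gtrBl; apply/andP. Qed.

Let Lp_lt0 : log2 p < 0. Proof. exact: log2_lt0. Qed.

Lemma I_integral_le W : claw_free_graphon W -> (I_integral p W <= (- rstar p)%:E)%E.
Proof.
move=> cW; have gW : graphon W by case: cW.
rewrite (I_integralE cW p01) lee_fin (le_trans (entropy_le cW p01))//.
have hbg := black_ge_grey cW.
have bW := bmeas_trunc_graphon gW.
have /andP[e0 e1] := mean_kernel_itv (bmeas_nonzero_kernel bW) (fun z => natr_bool_itv R _).
have /andP[f0 f1] := mean_kernel_itv (bmeas_nonone_kernel bW) (fun z => natr_bool_itv R _).
rewrite /rstar; case: ifPn => pc.
  rewrite opprK; apply: colour_bound_small => //.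
  - by rewrite -lt_p_crit_log.
  - by rewrite subr_ge0; exact: f1.
  - by rewrite subKr; exact: hbg.
rewrite mulNr opprK; apply: colour_bound_large => //.
- by rewrite leNgt -lt_p_crit_log.
- by rewrite subr_ge0; exact: e1.
- by rewrite subKr; exact: hbg.
Qed.

(** Equality in the linear program forces black density 0, and the key inequality then excludes
    grey. The zero kernel is written as a step kernel for use in [step_graphon_equiv]. *)
Lemma maximizer_small W : p < p_crit R -> claw_free_graphon W ->
  I_integral p W = (- rstar p)%:E ->
  (J_ x, J_ y, ((W \_ II) (x, y) - step_kernel 0 0 set0 (x, y)) ^+ 2) = 0.
Proof.
move=> pc cW; have gW : graphon W by case: cW.
rewrite (I_integralE cW p01) => -[] IW.
have := entropy_le cW p01; rewrite {}IW /rstar pc opprK => hI.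
have hbg := black_ge_grey cW.
have bW := bmeas_trunc_graphon gW.
have bE := bmeas_nonzero_kernel bW.
have /andP[e0 e1] := mean_kernel_itv (bmeas_nonzero_kernel bW) (fun z => natr_bool_itv R _).
have /andP[f0 f1] := mean_kernel_itv (bmeas_nonone_kernel bW) (fun z => natr_bool_itv R _).
have black0 := colour_eq_small L1_lt0 _ _ _ hI.
have JE : (J_ x, J_ y, nonzero_kernel (W \_ II) (x, y)) = 0.
  apply/eqP; rewrite eq_le e0 andbT (le_trans hbg)// black0 ?mulr0//.
  - by rewrite -lt_p_crit_log.
  - by rewrite subr_ge0; exact: f1.
  - by rewrite subKr; exact: hbg.
have bS := @bmeas_step_kernel 0 0 set0 measurable0.
set W0 : mR * mR -> R := W \_ II in bW bE JE *.
apply: (@JJ_on0 _ (nonzero_kernel W0) (fun z => (W0 z - step_kernel 0 0 set0 z) ^+ 2) bE _ JE).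
- by move=> z; have /andP[] := natr_bool_itv R (0 < W0 z).
- solve_bmeas.
move=> z; rewrite /nonzero_kernel /step_kernel mul0r addr0 subr0.
have /andP[+ _] : 0 <= W0 z <= 1 by exact: trunc_graphon_itv.
rewrite le_eqVlt => /predU1P[<-|->]; first by rewrite expr0n.
by move/eqP; rewrite oner_eq0.
Qed.

(** Equality in the linear program gives white density 0 and black density 1/2; then [F] is
    triangle-free of density 1/2, and the extremal case of Mantel's theorem provides [A]. *)
Lemma maximizer_large W : p_crit R < p -> claw_free_graphon W ->
  I_integral p W = (- rstar p)%:E ->
  exists A, [/\ measurable A, J \1_A = 1 / 2 &
    (J_ x, J_ y, ((W \_ II) (x, y) - step_kernel 1 (p - 1) A (x, y)) ^+ 2) = 0].
Proof.
have half : 1 - 1 / 2 = 1 / 2 :> R by lra.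
move=> pc cW; have gW : graphon W by case: cW.
rewrite (I_integralE cW p01) => -[] IW.
rewrite /rstar ltNge (ltW pc) /= mulNr opprK in IW.
have hI := entropy_le cW p01; rewrite IW in hI.
have hbg := black_ge_grey cW.
have bW := bmeas_trunc_graphon gW.
set W0 : mR * mR -> R := W \_ II in hbg bW hI IW *.
have W01 z : 0 <= W0 z <= 1 by exact: trunc_graphon_itv.
set E := nonzero_kernel W0 in hbg hI *; set F := nonone_kernel W0 in hbg hI *.
have bE : bmeas E by exact: bmeas_nonzero_kernel.
have bF : bmeas F by exact: bmeas_nonone_kernel.
have E01 z : 0 <= E z <= 1 by exact: natr_bool_itv.
have F01 z : 0 <= F z <= 1 by exact: natr_bool_itv.
have /andP[e0 e1] := mean_kernel_itv bE E01.
have /andP[f0 f1] := mean_kernel_itv bF F01.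
have [we bl] : 1 - (J_ x, J_ y, E (x, y)) = 0 /\ 1 - (J_ x, J_ y, F (x, y)) = 1 / 2.
  apply: (colour_eq_large Lp_lt0 _ _ _ hI).
  - exact: gt_p_crit_log.
  - by rewrite subr_ge0; exact: e1.
  - by rewrite subKr; exact: hbg.
have JE : (J_ x, J_ y, E (x, y)) = 1 by apply/esym/eqP; rewrite -subr_eq0 we.
have JF : (J_ x, J_ y, F (x, y)) = 1 / 2.
  by rewrite -[LHS](subKr 1) bl half.
have claw0 := claw_colours cW.
have Fsym x y : F (x, y) = F (y, x).
  by rewrite /F /nonone_kernel /W0 (trunc_graphon_sym gW).
have tri0 := full_claw_free_triangle_free bE bF E01 F01 JE claw0.
have F2 z : F z = 0 \/ F z = 1.
  by rewrite /F /nonone_kernel; case: (_ < _); [right|left].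
have [A [mA JA JFA]] := mantel_kernel_extremal bF F2 Fsym JF tri0.
exists A; split; [exact: mA|exact: JA|].
pose col z := log2 (1 - p) * (1 - E z) + log2 p * (1 - F z).
have bI : bmeas (fun z => I_ p (W0 z)) by exact: bmeas_I_.
have bcol : bmeas col by rewrite /col; solve_bmeas.
have bcut : bmeas (@cut_kernel R _ mR A).
  by have bA := @bmeas_indic R _ mR A mA; rewrite /cut_kernel; solve_bmeas.
have bS := bmeas_step_kernel 1 (p - 1) mA.
(* Three defects of mean zero: white pairs, entropy lost against the colour bound, and distance of
   [F] from the cut. Where all vanish, [W0] is [p] on [F] and 1 off it. *)
pose h1 z := 1 - E z.
pose h2 z := col z - I_ p (W0 z).
pose h3 z := (F z - cut_kernel A z) ^+ 2.
have b1 : bmeas h1 by rewrite /h1; solve_bmeas.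
have b2 : bmeas h2 by apply: bmeasD => //; exact: bmeasN.
have b3 : bmeas h3 by rewrite /h3; solve_bmeas.
have p1 z : 0 <= h1 z by rewrite subr_ge0; have /andP[] := E01 z.
have p2 z : 0 <= h2 z by rewrite subr_ge0; exact: I_le_col.
have p3 z : 0 <= h3 z by exact: sqr_ge0.
have q1 : (J_ x, J_ y, h1 (x, y)) = 0 by rewrite (JJ_1B bE).
have q2 : (J_ x, J_ y, h2 (x, y)) = 0.
  transitivity ((J_ x, J_ y, col (x, y)) + (J_ x, J_ y, (-1) * I_ p (W0 (x, y)))).
    rewrite -(JJ_D bcol (bmeasM (bmeas_cst _ (-1)) bI)).
    by apply: eqJ => x; apply: eqJ => y; rewrite mulN1r.
  rewrite (JJ_Z (-1) bI) mulN1r IW (JJ_col cW p) we bl mulr0 add0r [log2 p * _]mulrC.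
  by rewrite subrr.
apply: (@JJ_on0 _ (fun z => h1 z + (h2 z + h3 z))
  (fun z => (W0 z - step_kernel 1 (p - 1) A z) ^+ 2)).
- solve_bmeas.
- by move=> z; exact: (addr_ge0 (p1 z) (addr_ge0 (p2 z) (p3 z))).
- have q3 : (J_ x, J_ y, h3 (x, y)) = 0 by exact: JFA.
  have q23 : (J_ x, J_ y, h2 (x, y) + h3 (x, y)) = 0.
    by rewrite (JJ_D b2 b3) q2 q3 addr0.
  transitivity ((J_ x, J_ y, h1 (x, y)) + (J_ x, J_ y, h2 (x, y) + h3 (x, y))).
    exact: (JJ_D b1 (bmeasD b2 b3)).
  by rewrite q1 q23 addr0.
- solve_bmeas.
move=> z /eqP; rewrite (paddr_eq0 (p1 z) (addr_ge0 (p2 z) (p3 z))) (paddr_eq0 (p2 z) (p3 z)).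
move=> /and3P[/eqP z1 /eqP z2].
rewrite sqrf_eq0 subr_eq0 => /eqP z3.
have Ez : E z = 1 by apply/esym/eqP; rewrite -subr_eq0; apply/eqP.
have zI : I_ p (W0 z) = col z by apply/esym/eqP; rewrite -subr_eq0; apply/eqP.
rewrite /step_kernel -z3; case: (F2 z) => Fz; rewrite Fz; last first.
  have Wz : W0 z = p by exact: (I_eq_col p01 zI Ez Fz).
  by rewrite Wz mulr1 subrKC subrr expr0n.
rewrite mulr0 addr0; move: Fz; rewrite /F /nonone_kernel; case: ltP => [_ /eqP|].
  by rewrite oner_eq0.
move=> W1 _; have /andP[_ W1'] := W01 z.
by rewrite (_ : W0 z = 1) ?subrr ?expr0n//; apply/eqP; rewrite eq_le W1 W1'.
Qed.

End fixed_p.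
End maximizers.

(** * The extremal family of two equal cliques *)

Section two_cliques.
Context (R : realType).
Local Notation mR := (measurableTypeR R).
Local Notation I := (@unit_itv R).
Local Notation II := (I `*` I).
Local Notation U := (unit_prob R).

Local Notation "'J_' x , f" := (Rintegral U setT (fun x => f))
  (at level 200, x name, f at level 200, only parsing).
Local Notation J := (Rintegral U setT).

Lemma J_indic_itv (s t : R) : 0 <= s -> s <= t -> t <= 1 ->
  J \1_(`[s, t[%classic : set mR) = t - s.
Proof.
move=> s0 st t1.
have mI : measurable (`[s, t[%classic : set mR) by exact: measurable_itv.
rewrite /Rintegral unit_prob_integral; last 2 first.
- by apply/measurable_EFinP; exact: measurable_indic.
- by move=> x; rewrite lee_fin.
rewrite integral_indic//; last exact: measurable_unit_itv.
rewrite setIidl; last first.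
  move=> x; rewrite /unit_itv /= !in_itv /= => /andP[sx xt].
  by rewrite (le_trans s0 sx) (le_trans (ltW xt) t1).
rewrite [X in fine X](@lebesgue_measure_itv R `[s, t[) /= lte_fin; case: ltP => //= ts.
by apply/eqP; rewrite eq_sym subr_eq0 eq_le st ts.
Qed.

Section fixed_size.
Variables (p al : R) (p01 : 0 < p < 1) (al_ge0 : 0 <= al) (al_le : al <= 1 / 2).
Let al_le1 : al <= 1. Proof. by move: al_le; lra. Qed.
Let al2_le1 : 2 * al <= 1. Proof. by move: al_le; lra. Qed.
Let al_le2 : al <= 2 * al. Proof. by move: al_ge0; lra. Qed.
(** Half-open, so that the adjacent intervals [A] and [B] are disjoint; [al <= 1 / 2] keeps both in
    the unit interval. *)
Let A : set mR := `[0, al[%classic.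
Let B : set mR := `[al, 2 * al[%classic.
Let a : mR -> R := \1_A.
Let b : mR -> R := \1_B.

(* Two cliques of measure [al] joined by density [p], and isolated vertices. *)
Definition two_cliques (z : mR * mR) : mR :=
  a z.1 * a z.2 + b z.1 * b z.2 + p * (a z.1 * b z.2 + b z.1 * a z.2).

Let ba : bmeas a. Proof. by apply: bmeas_indic; exact: measurable_itv. Qed.
Let bb : bmeas b. Proof. by apply: bmeas_indic; exact: measurable_itv. Qed.

Let Ja : J a = al.
Proof. by rewrite /a /A (J_indic_itv (lexx 0) al_ge0 al_le1) subr0. Qed.

Let Jb : J b = al.
Proof. by rewrite /b /B (J_indic_itv al_ge0 al_le2 al2_le1) mulr2n mulrDl mul1r addrK. Qed.

Let types x : [\/ a x = 0 /\ b x = 0, a x = 1 /\ b x = 0 | a x = 0 /\ b x = 1].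
Proof.
rewrite /a /b !indicE; case xA : (x \in A); case xB : (x \in B) => /=.
- have := set_mem xA; have := set_mem xB.
  rewrite /A /B /= !in_itv /= => /andP[h' _] /andP[_ h].
  by move: (lt_le_trans h h'); rewrite ltxx.
- by apply: Or32.
- by apply: Or33.
- by apply: Or31.
Qed.

Let types_out x : ~ I x -> a x = 0 /\ b x = 0.
Proof.
move=> nI.
have nA : ~ A x.
  move=> h; apply: nI; move: h; rewrite /A /unit_itv /= !in_itv /= => /andP[h1 h2].
  by rewrite h1 (le_trans (ltW h2)).
have nB : ~ B x.
  move=> h; apply: nI; move: h; rewrite /B /unit_itv /= !in_itv /= => /andP[h1 h2].
  by rewrite (le_trans al_ge0 h1) (le_trans (ltW h2)).
by rewrite /a /b !indicE (memNset nA) (memNset nB).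
Qed.

Lemma bmeas_two_cliques : bmeas two_cliques.
Proof. by rewrite /two_cliques; solve_bmeas. Qed.

Lemma two_cliques_graphon : graphon two_cliques.
Proof.
split; first by apply: measurable_funTS; case: bmeas_two_cliques.
  by move=> x y _ _; rewrite /two_cliques /=; ring.
move=> x y _ _; have /andP[p0 p1] := p01; rewrite /two_cliques /=.
by case: (types x) => -[-> ->]; case: (types y) => -[-> ->];
  rewrite ?(mul0r, mul1r, addr0, add0r, mulr0, mulr1) ?lexx ?ler01 ?(ltW p0) ?(ltW p1).
Qed.

Lemma trunc_two_cliques : two_cliques \_ II = two_cliques.
Proof.
apply/funext => -[x y]; have [[Ix Iy]|nI] := pselect (II (x, y)).
  by rewrite trunc_graphonE.
rewrite trunc_graphon_out// /two_cliques /=.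
have [Ix|/types_out[-> ->]] := pselect (I x); last by ring.
have [Iy|/types_out[-> ->]] := pselect (I y); last by ring.
by case: nI.
Qed.

(* Two leaves in the same clique are adjacent, and a vertex outside the
   cliques is isolated. *)
Lemma two_cliques_claw_free : claw_free_graphon two_cliques.
Proof.
split; first exact: two_cliques_graphon.
rewrite (tind_clawE two_cliques_graphon) trunc_two_cliques; congr (_%:E).
pose f c x y z := two_cliques (c, x) * two_cliques (c, y) * two_cliques (c, z) *
    ((1 - two_cliques (x, y)) * (1 - two_cliques (y, z)) * (1 - two_cliques (x, z))).
have f0 c x y z : f c x y z = 0.
  rewrite /f /two_cliques /=.
  (* Of three leaves inside the cliques, two share a clique whatever the centre is, so the
     indicators of the centre are abstracted. *)
  move: (a c) (b c) => ac bc.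
  by case: (types x) => -[-> ->]; case: (types y) => -[-> ->];
    case: (types z) => -[-> ->]; ring.
transitivity (J_ c, J_ x, J_ y, J_ z, 0); last by rewrite !Jcst.
apply: eqJ => c; apply: eqJ => x; apply: eqJ => y; apply: eqJ => z; exact: f0.
Qed.

Lemma JJ_mul (f g : mR -> R) : bmeas f -> bmeas g ->
  (J_ x, J_ y, f x * g y) = J f * J g.
Proof.
move=> bf bg; rewrite -JZr//; apply: eqJ => x; rewrite JZ//.
Qed.

(** The cliques have total measure [2 * al], so white pairs have density [1 - 4 * al ^+ 2] and black
    ones [2 * al ^+ 2]; grey pairs contribute [I_ p p = 0]. *)
Lemma I_integral_two_cliques : I_integral p two_cliques =
  (log2 (1 - p) * (1 - 4 * al ^+ 2) + log2 p * (2 * al ^+ 2))%:E.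
Proof.
rewrite (I_integralE two_cliques_claw_free p01) trunc_two_cliques; congr (_%:E).
pose s x := a x + b x.
have bs : bmeas s by rewrite /s; solve_bmeas.
have Js : J s = 2 * al by rewrite (JD U ba bb) Ja Jb; ring.
set L1 := log2 (1 - p); set Lp := log2 p.
transitivity (J_ x, J_ y, L1 * (1 - s x * s y) + Lp * (a x * a y + b x * b y)).
  apply: eqJ => x; apply: eqJ => y; rewrite /two_cliques /s /=.
  case: (types x) => -[-> ->]; case: (types y) => -[-> ->];
  rewrite ?(mul0r, mul1r, addr0, add0r, mulr0, mulr1, subr0, subrr) ?I_0 ?I_1 ?I_p//.
pose ss (z : mR * mR) := s z.1 * s z.2.
pose aa (z : mR * mR) := a z.1 * a z.2.
pose bb2 (z : mR * mR) := b z.1 * b z.2.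
have bss : bmeas ss by rewrite /ss; solve_bmeas.
have baa : bmeas aa by rewrite /aa; solve_bmeas.
have bbb : bmeas bb2 by rewrite /bb2; solve_bmeas.
have b1 : bmeas (fun z => 1 - ss z) by solve_bmeas.
have b2 := bmeasD baa bbb.
have e1 : (J_ x, J_ y, 1 - ss (x, y)) = 1 - 4 * al ^+ 2.
  by rewrite (JJ_1B bss) (JJ_mul bs bs) Js; ring.
have e2 : (J_ x, J_ y, aa (x, y) + bb2 (x, y)) = 2 * al ^+ 2.
  by rewrite (JJ_D baa bbb) (JJ_mul ba ba) (JJ_mul bb bb) Ja Jb; ring.
have e3 := JJ_Z L1 b1; have e4 := JJ_Z Lp b2.
rewrite e1 in e3; rewrite e2 in e4; rewrite -e3 -e4.
exact: (JJ_D (bmeasM (bmeas_cst _ L1) b1) (bmeasM (bmeas_cst _ Lp) b2)).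
Qed.

(** This value determines [al >= 0], and so tells members of the family apart up to equivalence. *)
Lemma edge_density_two_cliques :
  hom_density (fun i j : 'I_2 => i != j) two_cliques = (2 * (1 + p) * al ^+ 2)%:E.
Proof.
rewrite (hom_densityE two_cliques_graphon) trunc_two_cliques; congr (_%:E).
transitivity (iterJ U 2 (fun t => two_cliques (tnth t ord0, tnth t ord_max))).
  apply: eq_iterJ => t; rewrite (big_pred1 (ord0, ord_max))// => -[i j] /=.
  rewrite xpair_eqE; case: (unliftP ord0 i) => [i'|] ->; case: (unliftP ord0 j) => [j'|] -> //;
  by rewrite ?(ord1 i') ?(ord1 j').
rewrite (iterJ_tnth2 U two_cliques (isT : (@ord0 1 < @ord_max 1)%N)).
pose aa (z : mR * mR) := a z.1 * a z.2.
pose bb2 (z : mR * mR) := b z.1 * b z.2.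
pose ab (z : mR * mR) := a z.1 * b z.2.
pose ba2 (z : mR * mR) := b z.1 * a z.2.
have baa : bmeas aa by rewrite /aa; solve_bmeas.
have bbb : bmeas bb2 by rewrite /bb2; solve_bmeas.
have bab : bmeas ab by rewrite /ab; solve_bmeas.
have bba : bmeas ba2 by rewrite /ba2; solve_bmeas.
transitivity ((J_ x, J_ y, aa (x, y) + bb2 (x, y)) + (J_ x, J_ y, p * (ab (x, y) + ba2 (x, y)))).
  exact: (JJ_D (bmeasD baa bbb) (bmeasM (bmeas_cst _ p) (bmeasD bab bba))).
rewrite (JJ_D baa bbb) (JJ_Z p (bmeasD bab bba)) (JJ_D bab bba).
rewrite (JJ_mul ba ba) (JJ_mul bb bb) (JJ_mul ba bb) (JJ_mul bb ba) Ja Jb.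
ring.
Qed.

End fixed_size.
End two_cliques.

(** * The value of [psi] and its maximizers *)

Lemma two_cliques_optimal (R : realType) (p : R) : 0 < p < 1 ->
  exists al, [/\ 0 <= al, al <= 1 / 2 &
    I_integral p (two_cliques p al) = (- rstar p)%:E].
Proof.
move=> p01; rewrite /rstar; case: ifPn => pc.
  (* Both cliques are empty: the zero graphon. *)
  exists 0; split=> //.
  rewrite I_integral_two_cliques ?divr_ge0// opprK.
  by rewrite expr0n /= !mulr0 subr0 mulr1 addr0.
(* The cliques fill the interval: no white pairs, and equal densities of black and grey. *)
exists (1 / 2); split=> //.
rewrite I_integral_two_cliques ?divr_ge0// mulNr opprK; congr (_%:E).
by field.
Qed.

Lemma psiE (R : realType) (p : R) : 0 < p < 1 -> psi p = (- rstar p)%:E.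
Proof.
move=> p01; apply/eqP; rewrite eq_le; apply/andP; split.
  by apply: ge_ereal_sup => _ [W cW <-]; exact: I_integral_le.
have [al [al0 al1 <-]] := two_cliques_optimal p01.
apply: ereal_sup_ubound; exists (two_cliques p al) => //.
exact: two_cliques_claw_free.
Qed.

Lemma maximizer_exists (R : realType) (p : R) : 0 < p < 1 ->
  exists W, achieves_psi p W.
Proof.
move=> p01; have [al [al0 al1 Ial]] := two_cliques_optimal p01.
exists (two_cliques p al); split; first exact: two_cliques_claw_free.
by rewrite psiE.
Qed.

(** At [p_crit] a black pair costs exactly twice a white one, so the terms in [al ^+ 2] cancel and
    every size is optimal. *)
Lemma achieves_psi_p_crit (R : realType) (al : R) : 0 <= al -> al <= 1 / 2 ->
  achieves_psi (p_crit R) (two_cliques (p_crit R) al).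
Proof.
move=> al0 al1; have pc01 := p_crit_itv R; split; first exact: two_cliques_claw_free.
rewrite psiE// I_integral_two_cliques// /rstar ltxx mulNr opprK p_crit_log.
by congr (_%:E); field.
Qed.

Lemma p_crit_infinitely_many (R : realType) : infinitely_many_maximizers (p_crit R).
Proof.
have /andP[pc0 pc1] := p_crit_itv R.
(* The shift by 2 keeps every size at most 1/2. *)
pose al k : R := k.+2%:R^-1.
have al0 k : 0 < al k by rewrite invr_gt0 ltr0n.
have al1 k : al k <= 1 / 2.
  by rewrite div1r lef_pV2 ?posrE ?ltr0n// ler_nat.
exists (fun k => two_cliques (p_crit R) (al k)); split.
  by move=> k; apply: achieves_psi_p_crit => //; exact: ltW.
move=> k l kl eqv.
have := eqv 2 (fun i j => i != j) (fun i j => congr1 negb (eq_sym i j)) (fun i => negbF (eqxx i)).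
rewrite !edge_density_two_cliques ?p_crit_itv ?(ltW (al0 _))// => -[].
have c0 : 2 * (1 + p_crit R) != 0.
  by rewrite mulf_neq0// gt_eqF// addr_gt0.
move/(mulfI c0)/eqP; rewrite eqrXn2 ?(ltW (al0 _))// => /eqP/invr_inj/eqP.
by rewrite eqr_nat !eqSS (negbTE kl).
Qed.

Theorem theorem1p4 (R : realType) :
  (forall p : R, 0 < p < 1 -> psi p = (- rstar p)%:E) /\
  (forall p : R, 0 < p < p_crit R -> unique_maximizer p) /\
  infinitely_many_maximizers (p_crit R) /\
  (forall p : R, p_crit R < p < 1 -> unique_maximizer p).
Proof.
have pc01 := p_crit_itv R; have /andP[pc0 pc1] := pc01.
split; first exact: psiE.
split.
  move=> p /andP[p0 pc]; have p01 : 0 < p < 1 by rewrite p0 (lt_trans pc).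
  split; first exact: maximizer_exists.
  move=> W1 W2 [cW1 h1] [cW2 h2]; rewrite psiE// in h1 h2.
  have [[gW1 _] [gW2 _]] := (cW1, cW2).
  exact: (step_graphon_equiv gW1 gW2 measurable0 measurable0 erefl
    (maximizer_small p01 pc cW1 h1) (maximizer_small p01 pc cW2 h2)).
split; first exact: p_crit_infinitely_many.
move=> p /andP[pc p1]; have p01 : 0 < p < 1 by rewrite p1 (lt_trans _ pc).
split; first exact: maximizer_exists.
move=> W1 W2 [cW1 h1] [cW2 h2]; rewrite psiE// in h1 h2.
have [A1 [mA1 JA1 hA1]] := maximizer_large p01 pc cW1 h1.
have [A2 [mA2 JA2 hA2]] := maximizer_large p01 pc cW2 h2.
have [[gW1 _] [gW2 _]] := (cW1, cW2).
(* [A1] and [A2] may differ, but both have measure 1/2, and the densities depend on nothing else. *)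
by apply: (step_graphon_equiv gW1 gW2 mA1 mA2 _ hA1 hA2); rewrite JA1 JA2.
Qed.
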